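(* Let $\mu\subset\lambda$ be Young diagrams, let $k=|\lambda/\mu|\ge 1$, and let $\rho=(\rho_1,\dots,\rho_r)$ be a partition of $k$. Let $\chi^{\lambda/\mu}$ be the character of the representation $V^{\lambda/\mu}$ of $S_k$. Then the value $\chi^{\lambda/\mu}_\rho$ of $\chi^{\lambda/\mu}$ on a permutation of cycle type $\rho$ equals $$\chi^{\lambda/\mu}_\rho=\sum_S(-1)^{\langle S\rangle},$$ where the sum is over all sequences $S$ of Young diagrams $$\mu=\lambda_0\subset\lambda_1\subset\lambda_2\subset\dots\subset\lambda_r=\lambda$$ such that each $\lambda_i/\lambda_{i-1}$ is a skew hook with $\rho_i$ boxes, and $\langle S\rangle=\sum_i\langle\lambda_i/\lambda_{i-1}\rangle$.
   Context: Representations are over $\mathbb{C}$. The content of a box is its column index minus its row index. For a partition $\lambda$ of $n$, $V^\lambda$ denotes the irreducible $S_n$-module having a basis $\{v_T\}$ indexed by standard Young tableaux $T$ of shape $\lambda$ with $X_iv_T=c_iv_T$, where $X_i=(1\,i)+\dots+(i-1\ i)$ ($i=1,\dots,n$) and $c_i$ is the content of the box of $T$ containing $i$. (This characterizes $V^\lambda$ up to isomorphism, and every irreducible $S_n$-module is of this form for a unique $\lambda$.) For $|\mu|=l$, $|\lambda|=l+k$, $\mu\subset\lambda$, set $V^{\lambda/\mu}=\mathrm{Hom}_{S_l}(V^\mu,V^\lambda)$, with $S_l\subset S_{l+k}$ permuting $1,\dots,l$; $S_k$, identified with the subgroup of $S_{l+k}$ permuting $l+1,\dots,l+k$ (via $i\mapsto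 l+i$), acts on it by post-composition. A skew diagram $\lambda/\mu$ is a skew hook if it is connected (via boxes sharing edges) and has no two boxes on the same diagonal, i.e. if the contents of its boxes form an interval in $\mathbb{Z}$ of cardinality $|\lambda/\mu|$. Its height $\langle\lambda/\mu\rangle$ is the number of rows it occupies minus $1$. *)

(* Defs.v *)
From mathcomp Require Import all_boot all_order all_algebra all_fingroup.
From mathcomp Require Import mxrepresentation.
From mathcomp Require Import finmap.
From mathcomp Require Import reals complex.

Set Implicit Arguments.
Unset Strict Implicit.
Unset Printing Implicit Defensive.

Import GRing.Theory.
Local Open Scope ring_scope.

(* Diagrams are finite sets of boxes.  A box is a pair (row, column), both
   counted from 0; the Young diagram of the partition p is
   {(i, j) | j < nth 0 p i}. *)
Definition box : Type := (nat * nat)%type.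
Notation diagram := {fset (nat * nat)}.

Definition row_of (b : box) : nat := b.1.
Definition col_of (b : box) : nat := b.2.

Definition content (b : box) : int := (col_of b)%:Z - (row_of b)%:Z.

(* Left-justified, with weakly decreasing row lengths: the box above and the
   box to the left of a box of D are in D.  On the border the truncated
   predecessor gives back the box itself. *)
Definition young (D : diagram) : bool :=
  [forall b : D, (((row_of (val b)).-1, col_of (val b)) \in D)
              && ((row_of (val b), (col_of (val b)).-1) \in D)].

Definition is_partition (k : nat) (rho : seq nat) : bool :=
  [&& sorted geq rho, 0%N \notin rho & sumn rho == k].

(* A tableau of shape D with n boxes is given by its inverse: T i is the box
   that contains the entry i + 1. *)
Definition standard n (D : diagram) (T : {ffun 'I_n -> D}) : bool :=
  [&& injectiveb T, [forall b : D, b \in codom T],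
      [forall i, forall j,
         (row_of (val (T i)) == row_of (val (T j)))
         && (col_of (val (T i)) < col_of (val (T j)))%N ==> (i < j)%N]
    & [forall i, forall j,
         (col_of (val (T i)) == col_of (val (T j)))
         && (row_of (val (T i)) < row_of (val (T j)))%N ==> (i < j)%N]].

Notation syt n D := {T : {ffun 'I_n -> D} | standard T}.

Definition adjacent (b b' : box) : bool :=
  ((row_of b == row_of b') && ((col_of b).+1 == col_of b'))
  || ((row_of b == row_of b') && ((col_of b').+1 == col_of b))
  || ((col_of b == col_of b') && ((row_of b).+1 == row_of b'))
  || ((col_of b == col_of b') && ((row_of b').+1 == row_of b)).

Definition connected (D : diagram) : bool :=
  [forall b : D, forall b' : D,
     connect [rel x y : D | adjacent (val x) (val y)] b b'].

(* In the next two definitions D is a skew diagram la `\` mu. *)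
Definition skew_hook (D : diagram) : bool :=
  connected D
  && [forall b : D, forall b' : D,
        (content (val b) == content (val b')) ==> (b == b')].

Definition height (D : diagram) : nat :=
  (#|` [fset row_of b | b in D]%fset|).-1.

(* The sequences mu = S_0, S_1, ..., S_r = la in the sum; all their terms are
   subsets of la, so they range over the finite type of functions from
   {0, ..., r} to the subsets of la. *)
Definition hook_seq (mu la : diagram) (rho : seq nat)
    (S : {ffun 'I_(size rho).+1 -> fpowerset la}) : bool :=
  [&& val (S ord0) == mu, val (S ord_max) == la,
      [forall i, young (val (S i))]
    & [forall i : 'I_(size rho),
         let Dprev := val (S (widen_ord (leqnSn _) i)) in
         let Dnext := val (S (lift ord0 i)) in
         [&& (Dprev `<=` Dnext)%fset, skew_hook (Dnext `\` Dprev)%fset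
           & #|` (Dnext `\` Dprev)%fset| == nth 0%N rho i]]].

Definition seq_height (la : diagram) (r : nat)
    (S : {ffun 'I_r.+1 -> fpowerset la}) : nat :=
  (\sum_(i < r) height (val (S (lift ord0 i))
                        `\` val (S (widen_ord (leqnSn _) i)))%fset)%N.

(* Fixed points count as cycles of length 1. *)
Definition cycle_type k (s : 'S_k) : seq nat :=
  sort geq (map (fun O : {set 'I_k} => #|O|) (enum (porbits s))).

Section Representations.
Variable F : fieldType.

(* A matrix representation rG acts on row vectors by v |-> v *m rG s.  The
   product s * t of permutations is "first s, then t", so this is a left
   action for the usual composition of permutations. *)

Definition jucys_murphy n d (rG : mx_representation F [set: 'S_n] d)
    (i : 'I_n) : 'M[F]_d :=
  \sum_(j < n | (j < i)%N) rG (tperm j i).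

(* rG is (isomorphic to) the irreducible module V^la. *)
Definition is_irr_of_shape n (la : diagram) d
    (rG : mx_representation F [set: 'S_n] d) : Prop :=
  mx_irreducible rG /\
  exists v : syt n la -> 'rV[F]_d,
    basis_of fullv [seq v T | T : syt n la] /\
    forall (T : syt n la) (i : 'I_n),
      v T *m jucys_murphy rG i = (content (val (val T i)))%:~R *: v T.

Section Embeddings.
Variables l k : nat.

Definition emb_first_fun (s : 'S_l) (i : 'I_(l + k)) : 'I_(l + k) :=
  match split i with inl a => lshift k (s a) | inr b => rshift l b end.
Definition emb_last_fun (s : 'S_k) (i : 'I_(l + k)) : 'I_(l + k) :=
  match split i with inl a => lshift k a | inr b => rshift l (s b) end.

Lemma emb_first_inj (s : 'S_l) : injective (emb_first_fun s).
Proof.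
move=> i j; rewrite /emb_first_fun -{2}(splitK i) -{2}(splitK j).
case: (split i) => a; case: (split j) => b /=.
- by move/lshift_inj/perm_inj->.
- by move/eqP; rewrite eq_lrshift.
- by move/eqP; rewrite eq_rlshift.
- by [].
Qed.

Lemma emb_last_inj (s : 'S_k) : injective (emb_last_fun s).
Proof.
move=> i j; rewrite /emb_last_fun -{2}(splitK i) -{2}(splitK j).
case: (split i) => a; case: (split j) => b /=.
- by [].
- by move/eqP; rewrite eq_lrshift.
- by move/eqP; rewrite eq_rlshift.
- by move/rshift_inj/perm_inj->.
Qed.

Definition emb_first (s : 'S_l) : 'S_(l + k) := perm (@emb_first_inj s).
Definition emb_last (s : 'S_k) : 'S_(l + k) := perm (@emb_last_inj s).

Lemma emb_firstL s a : emb_first s (lshift k a) = lshift k (s a).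
Proof. by rewrite permE /emb_first_fun -[lshift k a]/(unsplit (inl a)) unsplitK. Qed.
Lemma emb_firstR s b : emb_first s (rshift l b) = rshift l b.
Proof. by rewrite permE /emb_first_fun -[rshift l b]/(unsplit (inr b)) unsplitK. Qed.
Lemma emb_lastL s a : emb_last s (lshift k a) = lshift k a.
Proof. by rewrite permE /emb_last_fun -[lshift k a]/(unsplit (inl a)) unsplitK. Qed.
Lemma emb_lastR s b : emb_last s (rshift l b) = rshift l (s b).
Proof. by rewrite permE /emb_last_fun -[rshift l b]/(unsplit (inr b)) unsplitK. Qed.

Lemma emb_last1 : emb_last 1 = 1%g.
Proof.
apply/permP=> i; rewrite -(splitK i).
by case: (split i) => a /=; rewrite ?emb_lastL ?emb_lastR !perm1.
Qed.

Lemma emb_lastM s t : emb_last (s * t) = (emb_last s * emb_last t)%g.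
Proof.
apply/permP=> i; rewrite -(splitK i).
by case: (split i) => a /=; rewrite permM ?emb_lastL ?emb_lastR ?permM.
Qed.

Lemma emb_comm s t : (emb_first s * emb_last t = emb_last t * emb_first s)%g.
Proof.
apply/permP=> i; rewrite -(splitK i).
by case: (split i) => a /=;
  rewrite !permM ?(emb_lastL, emb_lastR, emb_firstL, emb_firstR).
Qed.

End Embeddings.

Section SkewRepresentation.
Variables (l k dmu dla : nat).
Variable rmu : mx_representation F [set: 'S_l] dmu.
Variable rla : mx_representation F [set: 'S_(l + k)] dla.

(* A linear map from the space of rmu to that of rla is a matrix A (acting by
   v |-> v *m A), handled as the row vector mxvec A; hom_space is the matrix
   whose row space is the set of S_l-equivariant maps (see hom_spaceP). *)
Definition hom_space : 'M[F]_(dmu * dla) :=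
  (\bigcap_(g : 'S_l)
     kermx (lin_mulmx (rmu g) - lin_mulmxr (rla (emb_first k g))))%MS.

Lemma hom_spaceP (A : 'M[F]_(dmu, dla)) :
  reflect (forall g : 'S_l, rmu g *m A = A *m rla (emb_first k g))
          (mxvec A <= hom_space)%MS.
Proof.
apply: (iffP sub_bigcapmxP) => [H g | H g _].
  have /sub_kermxP := H g isT.
  rewrite mulmxBr !mul_vec_lin /= -linearB => /eqP.
  by rewrite mxvec_eq0 subr_eq0 => /eqP.
by apply/sub_kermxP; rewrite mulmxBr !mul_vec_lin /= H subrr.
Qed.

(* S_k acting by post-composition on all linear maps. *)
Definition postcomp_mx (s : 'S_k) : 'M[F]_(dmu * dla) :=
  lin_mulmxr (rla (emb_last l s)).

Lemma postcomp_mx_repr : mx_repr [set: 'S_k] postcomp_mx.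
Proof.
split=> [|s t _ _]; apply/row_matrixP=> i; rewrite !rowE -(vec_mxK (delta_mx _ _)).
  by rewrite mul_vec_lin /= emb_last1 repr_mx1 !mulmx1.
by rewrite mulmxA !mul_vec_lin /= emb_lastM repr_mxM ?inE // mulmxA.
Qed.
Canonical postcomp_repr := MxRepresentation postcomp_mx_repr.

Lemma hom_space_module : mxmodule postcomp_repr hom_space.
Proof.
apply/mxmoduleP=> s _; apply/row_subP=> i; rewrite row_mul.
have := row_sub i hom_space; rewrite -(vec_mxK (row i hom_space)).
move/hom_spaceP=> H; rewrite mul_vec_lin /=; apply/hom_spaceP=> g.
by rewrite mulmxA H -!mulmxA -!repr_mxM ?inE // emb_comm.
Qed.

(* V^(la/mu) = Hom_{S_l}(V^mu, V^la) as a representation of S_k. *)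
Definition skew_repr :
    mx_representation F [set: 'S_k] (\rank hom_space) :=
  submod_repr hom_space_module.

Definition skew_char (s : 'S_k) : F := \tr (skew_repr s).

End SkewRepresentation.
End Representations.

(* Main.v *)
Require Import Defs.
From mathcomp Require Import all_boot all_order all_algebra all_fingroup.
From mathcomp Require Import mxrepresentation.
From mathcomp Require Import finmap zify.
From mathcomp Require Import reals complex.

Set Implicit Arguments.
Unset Strict Implicit.
Unset Printing Implicit Defensive.

Import Order.TTheory GRing.Theory Num.Theory.
Local Open Scope fset_scope.
Local Open Scope ring_scope.

(* Write s_i = (i i+1) and let v_T be the Jucys-Murphy eigenbasis of V^la.  The
   relation X_i s_i = s_i X_(i+1) - 1 shows that the diagonal coefficient of
   s_i at v_T is 1 / (c_(i+1) - c_i), and that the diagonal coefficient of a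
   product of distinct s_i taken in increasing order is the product of these
   numbers.  Averaging over S_l expresses the skew character through
   (1 / l!) sum_g chi^mu(g^-1) tr (g s | T restricted to {1..l} has shape mu);
   the inner trace factors as chi^mu(g) times a sum over the growth sequences
   from mu to la, and Schur's lemma removes the first factor.

   Cutting a growth sequence according to rho leaves one sum for each step
   D of the chain: the sum of prod 1 / (c_(i+1) - c_i) over the standard
   fillings of the skew diagram D (Greene's identity).  With the extra factor
   1 / (c_1 - u) this sum is a product over the boxes x of D of
     0              if the upper left neighbour of x is in D, and otherwise
     u - c_x        if both the left and the upper neighbour are in D,
     1              if only the left one is,
     -1             if only the upper one is,
     -1 / (u - c_x) if none is.
   Removing a first box b is a partial fraction expansion at u = c_b, and the
   coefficient at infinity vanishes unless D is a skew hook, where it is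
   (-1)^height. *)

(** * Jucys-Murphy elements and products of adjacent transpositions *)

(* The i-th bit of the mask m tells whether the positions i and i + 1 of the
   sequence are linked. *)
Fixpoint chain_prod (T : finType) (m : bitseq) (s : seq T) : {perm T} :=
  match m, s with
  | b :: m', x :: ((y :: _) as s') =>
      ((if b then tperm x y else 1) * chain_prod m' s')%g
  | _, _ => 1%g
  end.

(** For a run of consecutive entries of a tableau, read through their contents, this is the diagonal
    coefficient of [chain_prod], by [entry_chain_prod]. *)
Fixpoint chain_wt (F : fieldType) (m : bitseq) (c : seq F) : F :=
  match m, c with
  | b :: m', x :: ((y :: _) as c') =>
      (if b then (y - x)^-1 else 1) * chain_wt m' c'
  | _, _ => 1
  end.

Section JucysMurphy.
Variables (F : fieldType) (n d : nat) (rG : mx_representation F [set: 'S_n] d).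
Local Notation X := (jucys_murphy rG).

(** Conjugation by [g] permutes the transpositions [(j i)] with [j < i]. *)
Lemma jm_commute (g : 'S_n) (i : 'I_n) :
  g i = i -> (forall j, (g j < i)%N = (j < i)%N) ->
  X i *m rG g = rG g *m X i.
Proof.
move=> gi gj; rewrite /jucys_murphy mulmx_suml mulmx_sumr.
rewrite [RHS](reindex_inj (@perm_inj _ g)) /=.
apply: eq_big => [j|j _]; first by rewrite gj.
by rewrite -!repr_mxM ?inE // conjgC tpermJ gi.
Qed.

(** Conjugation by [(x y)] turns the summands [(j x)] of [X x] into the summands [(j y)] of [X y]
    with [j < x]; the remaining summand [(x y)] of [X y] accounts for the identity matrix. *)
Lemma jm_braid (x y : 'I_n) : val y = (val x).+1 ->
  X x *m rG (tperm x y) = rG (tperm x y) *m X y - 1%:M.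
Proof.
move=> xy; have ltxy : (x < y)%N by rewrite xy.
rewrite /jucys_murphy mulmx_suml mulmx_sumr [in RHS](bigD1 x) //=.
rewrite -repr_mxM ?inE // tperm2 repr_mx1 [RHS]addrC addrA addNr add0r.
apply: eq_big => [j|j jx].
  by rewrite [in RHS]/leq -[val y]/(nat_of_ord y) xy ltn_neqAle andbC.
rewrite -!repr_mxM ?inE // conjgC tpermJ tpermL tpermD //.
  by rewrite neq_ltn jx orbT.
by rewrite neq_ltn (ltn_trans jx ltxy) orbT.
Qed.

End JucysMurphy.

Lemma chain_prod_out (T : finType) m (s : seq T) z :
  z \notin s -> chain_prod m s z = z.
Proof.
elim: s m => [|x [|y s] IHs] [|b m] //= z_s; rewrite ?perm1 //.
rewrite permM; have zxy : (if b then tperm x y else 1%g) z = z.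
  case: b; rewrite ?perm1 // tpermD //; apply: contraNneq z_s => ->;
  by rewrite !inE eqxx ?orbT.
by rewrite zxy IHs //; apply: contra z_s => zs; rewrite inE zs orbT.
Qed.

(** * Matrix coefficients in a Jucys-Murphy eigenbasis *)

Section DualBasis.
Variables (F : fieldType) (I : finType) (d : nat).
Variables (v : I -> 'rV[F]_d) (w : I -> 'cV[F]_d).
Hypothesis vw : forall T T', v T *m w T' = (T == T')%:R%:M.
Hypothesis wv : \sum_T w T *m v T = 1%:M.

(** As [w] is dual to [v], this is the coefficient of [v T'] in [v T *m K]. *)
Definition entry (K : 'M[F]_d) (T T' : I) : F := (v T *m K *m w T') 0 0.

Lemma entryE K T T' : v T *m K *m w T' = (entry K T T')%:M.
Proof. by rewrite [LHS]mx11_scalar. Qed.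

Lemma entryM K L T T' :
  entry (K *m L) T T' = \sum_U entry K T U * entry L U T'.
Proof.
rewrite {1}/entry mulmxA -[v T *m K in LHS]mulmx1 -wv mulmx_sumr.
rewrite !mulmx_suml summxE; apply: eq_bigr => U _.
rewrite mulmxA entryE -mulmxA -mulmxA (mulmxA (v U)) entryE.
by rewrite -scalar_mxM [LHS]mxE eqxx mulr1n.
Qed.

Lemma mxtrace_entry K : \tr K = \sum_T entry K T T.
Proof.
rewrite -[K in LHS]mulmx1 -wv mulmx_sumr raddf_sum /=.
by apply: eq_bigr => T _; rewrite mulmxA mxtrace_mulC mulmxA trace_mx11.
Qed.

Lemma entryB K L T T' : entry (K - L) T T' = entry K T T' - entry L T T'.
Proof. by rewrite /entry mulmxBr mulmxBl !mxE. Qed.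

Lemma entry1 T T' : entry 1%:M T T' = (T == T')%:R.
Proof. by rewrite /entry mulmx1 vw mxE mulr1n. Qed.

Section Eigen.
Variables (K : 'M[F]_d) (c : I -> F).
Hypothesis vK : forall T, v T *m K = c T *: v T.

Lemma dual_eigen T : K *m w T = c T *: w T.
Proof.
rewrite -[K *m w T]mul1mx -wv mulmx_suml (bigD1 T) //= big1 ?addr0.
  by rewrite -mulmxA (mulmxA (v T)) vK -scalemxAl vw eqxx -scalemxAr mulmx1.
move=> U UT; rewrite -mulmxA (mulmxA (v U)) vK -scalemxAl vw (negPf UT).
by rewrite raddf0 !(mulmx0, scaler0).
Qed.

Lemma entry_eigenl L T T' : entry (K *m L) T T' = c T * entry L T T'.
Proof. by rewrite /entry mulmxA vK -!scalemxAl mxE. Qed.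

Lemma entry_eigenr L T T' : entry (L *m K) T T' = entry L T T' * c T'.
Proof.
by rewrite /entry mulmxA -[_ *m K *m _]mulmxA dual_eigen -scalemxAr mxE mulrC.
Qed.

(** In the coefficient of [K *m L] the factor [K] acts as [c T], in that of [L *m K] as [c T']. *)
Lemma entry_comm_eigen L T T' : K *m L = L *m K ->
  entry L T T' != 0 -> c T = c T'.
Proof.
move=> KL nz; apply: (mulIf nz).
by rewrite -entry_eigenl KL entry_eigenr mulrC.
Qed.

End Eigen.

Section JMBasis.
Variables (n : nat) (rG : mx_representation F [set: 'S_n] d).
Variable c : I -> 'I_n -> F.
Hypothesis vX : forall T i, v T *m jucys_murphy rG i = c T i *: v T.

(** This is the [(T, T')] coefficient of [jm_braid], where both Jucys-Murphy factors act by
    scalars. *)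
Lemma entry_tperm (x y : 'I_n) T T' : val y = (val x).+1 ->
  entry (rG (tperm x y)) T T' * (c T' y - c T x) = (T == T')%:R.
Proof.
move=> xy; have := congr1 (fun K => entry K T T') (jm_braid rG xy).
rewrite /= entryB entry1 (entry_eigenl (fun T => vX T x)).
rewrite (entry_eigenr (fun T => vX T y)) => /esym/eqP.
by rewrite subr_eq addrC -subr_eq mulrBr (mulrC _ (c T x)) => /eqP.
Qed.

(* A return to T must avoid every swap: the factors after the swap at x
   commute with X_x, so they cannot undo its effect on the x-th eigenvalue. *)
Lemma entry_chain_prod m x (s : seq 'I_n) T :
  path (fun x y : 'I_n => val y == (val x).+1) x s ->
  entry (rG (chain_prod m (x :: s))) T T = chain_wt m (map (c T) (x :: s)).
Proof.
elim: s x m => [|y s IHs] x [|b m]; rewrite ?repr_mx1 ?entry1 ?eqxx // => xs.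
have /=/andP[/eqP xy ys] := xs.
rewrite -[c T y :: _]/(map (c T) (y :: s)).
rewrite -IHs //; case: b; last by rewrite mul1g mul1r.
have x_lt z : z \in y :: s -> (x < z)%N.
  have tr : transitive (fun x y : 'I_n => (x < y)%N).
    by move=> ? ? ?; apply: ltn_trans.
  apply/allP: z; apply: (order_path_min tr); apply: sub_path xs => i j /eqP /= ij.
  by rewrite ij.
set g := chain_prod m (y :: s).
have gfix (z : 'I_n) : (z <= x)%N -> g z = z.
  move=> zx; apply: chain_prod_out; apply/negP => /x_lt.
  by rewrite ltnNge zx.
have comm_g : jucys_murphy rG x *m rG g = rG g *m jucys_murphy rG x.
  apply: jm_commute; first exact: gfix.
  move=> j; apply/idP/idP => jx; last by rewrite gfix // ltnW.
  by rewrite -(perm_inj (gfix (g j) (ltnW jx))).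
have TT := entry_tperm T T xy.
(* On the diagonal [entry_tperm] has right-hand side 1, so consecutive eigenvalues always differ. *)
have nzT U : c U y - c U x != 0.
  apply/eqP=> Ueq; have := entry_tperm U U xy.
  by rewrite Ueq mulr0 eqxx => /esym/eqP; rewrite oner_eq0.
rewrite repr_mxM ?inE // entryM (bigD1 T) //= big1 ?addr0.
  congr (_ * _); apply: (mulIf (nzT T)).
  by rewrite TT eqxx mulVf.
(* A nonzero coefficient of [g] from [U] to [T] gives [c U x = c T x]. The factor [c U y - c T x] in
   [entry_tperm] is then nonzero, and the swap has coefficient 0 from [T] to [U]. *)
move=> U UT; have [->|nz] := eqVneq (entry (rG g) U T) 0; first by rewrite mulr0.
have := entry_tperm T U xy; rewrite eq_sym (negPf UT).
rewrite -(entry_comm_eigen (fun T => vX T x) comm_g nz) => /eqP.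
by rewrite mulf_eq0 (negPf (nzT U)) orbF => /eqP->; rewrite mul0r.
Qed.

End JMBasis.
End DualBasis.

(** The columns hold the coordinate functionals of the basis, evaluated at the unit row vectors. *)
Lemma dual_basis (F : fieldType) (I : finType) d (v : I -> 'rV[F]_d) :
  basis_of fullv [seq v T | T : I] ->
  exists w : I -> 'cV[F]_d,
    (forall T T', v T *m w T' = (T == T')%:R%:M)
    /\ \sum_T w T *m v T = 1%:M.
Proof.
pose Y := codom_tuple v => bas_v.
have bY : basis_of fullv Y by rewrite /Y /= /codom; apply: etrans bas_v.
have fY := basis_free bY.
exists (fun T => \col_i coord Y (enum_rank T) (delta_mx 0 i)); split.
  move=> T T'; rewrite [LHS]mx11_scalar; congr _%:M.
  rewrite mxE; transitivity (coord Y (enum_rank T') (v T)).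
    rewrite [v T in RHS]row_sum_delta linear_sum /=; apply: eq_bigr => i _.
    by rewrite mxE linearZ.
  rewrite (_ : v T = Y`_(enum_rank T)); last by rewrite nth_codom enum_rankK.
  by rewrite coord_free // (inj_eq enum_rank_inj) eq_sym.
apply/row_matrixP => i; rewrite row1 linear_sum /=.
rewrite [RHS](coord_basis bY) ?memvf //.
rewrite [RHS](reindex enum_rank) /=; last exact/onW_bij/enum_rank_bij.
apply: eq_bigr => T _; rewrite row_mul nth_codom enum_rankK.
by rewrite [row i _]mx11_scalar mul_scalar_mx !mxE.
Qed.

(** * Cycle decomposition *)

(** A part [p] gives [p - 1] links and then a break, so bits and positions stay aligned. A part 0
    would still take one bit; later statements therefore assume positive parts. *)
Definition block_mask (rho : seq nat) : bitseq :=
  flatten [seq rcons (nseq p.-1 true) false | p <- rho].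

Definition cycle_prod (T : finType) (b : seq T) : {perm T} :=
  chain_prod (nseq (size b).-1 true) b.

Lemma chain_prod_block_cat (T : finType) p m (b s : seq T) :
  size b = p.+1 ->
  chain_prod (rcons (nseq p true) false ++ m) (b ++ s)
  = (chain_prod (nseq p true) b * chain_prod m s)%g.
Proof.
elim: p b => [|p IHp] [|x b] //=.
  by case: b => // _; case: s => [|y s] /=; rewrite ?mul1g //; case: m.
case: b => [//|y b] [sz_b].
by have /= -> := IHp (y :: b) (congr1 _ sz_b); rewrite mulgA.
Qed.

Lemma chain_prod_block_mask (T : finType) (bss : seq (seq T)) :
  all (fun b => b != [::]) bss ->
  chain_prod (block_mask (map size bss)) (flatten bss)
  = (\prod_(b <- bss) cycle_prod b)%g.
Proof.
elim: bss => [|b bss IHbss] /=; first by rewrite big_nil.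
case/andP=> b0 /IHbss E; rewrite big_cons -E.
rewrite /block_mask /= chain_prod_block_cat //.
by case: (b) b0.
Qed.

Lemma chain_prod_conj (T : finType) m (s : seq T) (t : {perm T}) :
  chain_prod m (map t s) = (chain_prod m s ^ t)%g.
Proof.
elim: s m => [|x [|y s] IHs] [|b m] //=; rewrite ?conj1g //.
have /= -> := IHs m; rewrite conjMg; congr (_ * _)%g.
by case: b; rewrite ?tpermJ ?conj1g.
Qed.

Section CycleDecomposition.
Variables (T : finType) (s : {perm T}).

(** The leftmost transposition acts first, so [x] is carried along to the last element and every
    other element to its predecessor. A cycle of [s] must therefore be listed along the inverse of
    [s]. *)
Lemma cycle_prod_fpath x b : uniq (x :: b) -> fpath (s^-1)%g x b ->
  forall z, cycle_prod (x :: b) z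
            = if z == x then last x b else if z \in b then s z else z.
Proof.
elim: b x => [|y b IHb] x.
  by move=> _ _ z /=; rewrite perm1; case: eqP.
move=> /= /andP[]; rewrite inE negb_or => /andP[xy x_b] uyb /andP[/eqP sxy yb] z.
have -> : cycle_prod [:: x, y & b] = (tperm x y * cycle_prod (y :: b))%g by [].
have sy : s y = x by rewrite -sxy permKV.
rewrite permM (IHb _ uyb yb); case: (eqVneq z x) => [->|zx].
  by rewrite tpermL eqxx.
case: (eqVneq z y) => [->|zy].
  by rewrite tpermR (negPf xy) (negPf x_b) inE eqxx sy.
have -> : tperm x y z = z by rewrite tpermD // eq_sym.
by rewrite (negPf zy) inE (negPf zy).
Qed.

Definition porbit_seq (x : T) : seq T := traject (s^-1)%g x #|porbit s x|.

Lemma uniq_porbit_seq x : uniq (porbit_seq x).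
Proof. by rewrite /porbit_seq -porbitV uniq_traject_porbit. Qed.

Lemma mem_porbit_seq x : porbit_seq x =i porbit s x.
Proof. by move=> y; rewrite /porbit_seq -porbitV -porbit_traject. Qed.

Lemma cycle_prod_porbit x z :
  cycle_prod (porbit_seq x) z = if z \in porbit s x then s z else z.
Proof.
have := uniq_porbit_seq x; rewrite -mem_porbit_seq.
have := iter_porbit (s^-1)%g x; rewrite porbitV /porbit_seq.
have : #|porbit s x| != 0%N by apply: card_porbit_neq0.
case: #|_| => // p _ /= it u.
rewrite cycle_prod_fpath ?fpath_traject // inE; case: eqVneq => //= ->.
by rewrite last_traject -{2}it permKV.
Qed.

Lemma porbit_perm1 x : porbit s (s x) = porbit s x.
Proof. exact: (porbit_perm s 1). Qed.

Lemma prod_cycle_porbit (xs : seq T) :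
  uniq (flatten (map porbit_seq xs)) -> forall z,
  (\prod_(x <- xs) cycle_prod (porbit_seq x))%g z
  = if z \in flatten (map porbit_seq xs) then s z else z.
Proof.
elim: xs => [|x xs IHxs] /=; first by move=> _ z; rewrite big_nil perm1.
rewrite cat_uniq => /and3P[_ /hasPn disj u] z.
rewrite big_cons permM cycle_prod_porbit IHxs // mem_cat mem_porbit_seq.
case: (boolP (z \in porbit s x)) => //= z_x; case: ifP => // szin; have := disj _ szin.
by rewrite mem_porbit_seq -eq_porbit_mem porbit_perm1 eq_porbit_mem z_x.
Qed.

End CycleDecomposition.

Lemma cycle_decomposition n (s : 'S_n) :
  exists bss : seq (seq 'I_n),
    [/\ perm_eq (flatten bss) (enum 'I_n), all (fun b => b != [::]) bss,
        map size bss = cycle_type s & s = (\prod_(b <- bss) cycle_prod b)%g].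
Proof.
(* The orbits are sorted as in [cycle_type], so that the sizes agree as sequences and not only up to
   order. *)
pose Os := sort (relpre (fun O : {set 'I_n} => #|O|) geq) (enum (porbits s)).
have OsP O : (O \in Os) = (O \in porbits s) by rewrite mem_sort mem_enum.
have [xs xsE] : exists xs, map (porbit s) xs = Os.
  have : {subset Os <= porbits s} by move=> O; rewrite OsP.
  elim: (Os) => [|O Os' IH] sub; first by exists [::].
  have [|xs <-] := IH; first by move=> O' O'in; rewrite sub // inE O'in orbT.
  have /imsetP[x _ ->] := sub O (mem_head _ _).
  by exists (x :: xs).
pose bss := map (porbit_seq s) xs.
have Osu : uniq Os by rewrite sort_uniq enum_uniq.
have u : uniq (flatten bss).
  move: Osu; rewrite -xsE /bss; elim: (xs) => //= x xs' IH /andP[x_n /IH u].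
  rewrite cat_uniq uniq_porbit_seq u andbT /=; apply/hasPn => y.
  case/flattenP => b /mapP[x' x'_in ->]; rewrite !mem_porbit_seq => yx'.
  apply: contra x_n; rewrite -eq_porbit_mem => /eqP <-.
  by apply/mapP; exists x' => //; apply/eqP; rewrite eq_porbit_mem.
have fl y : y \in flatten bss.
  have : porbit s y \in Os by rewrite OsP; apply: imset_f.
  rewrite -xsE => /mapP[x x_in xy]; apply/flattenP; exists (porbit_seq s x).
    exact: map_f.
  by rewrite mem_porbit_seq -eq_porbit_mem xy.
exists bss; split.
- by apply: uniq_perm; rewrite ?enum_uniq // => y; rewrite fl mem_enum.
- apply/allP => b /mapP[x _ ->]; rewrite -size_eq0 size_traject.
  exact: card_porbit_neq0.
- rewrite /cycle_type -[map _ (enum _)]/(map _ _) sort_map -/Os -xsE -!map_comp.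
  by apply: eq_map => x /=; rewrite size_traject.
- apply/permP => z; rewrite /bss big_map prod_cycle_porbit //.
  by rewrite -/bss fl.
Qed.

Lemma cycle_type_neq0 n (s : 'S_n) : 0%N \notin cycle_type s.
Proof.
have [bss [_ nz <- _]] := cycle_decomposition s.
apply/negP => /mapP[b /(allP nz) b0 sz].
by rewrite -size_eq0 -sz in b0.
Qed.

Lemma sumn_cycle_type n (s : 'S_n) : sumn (cycle_type s) = n.
Proof.
have [bss [perm_b _ <- _]] := cycle_decomposition s.
by rewrite -[map _ _]/(shape _) -size_flatten (perm_size perm_b) size_enum_ord.
Qed.

(** The cycles of [s], written one after the other, list all of ['I_n]; [t] carries the natural
    order to this list. *)
Lemma conj_chain_prod n (s : 'S_n) :
  exists t, s = (chain_prod (block_mask (cycle_type s)) (enum 'I_n) ^ t)%g.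
Proof.
have [bss [perm_b nz szs sE]] := cycle_decomposition s.
have sz_f : size (flatten bss) = n by rewrite (perm_size perm_b) size_enum_ord.
pose X := Tuple (introT eqP sz_f).
have inj_X : injective (tnth X).
  by apply/tuple_uniqP; rewrite (perm_uniq perm_b) enum_uniq.
exists (perm inj_X); rewrite -chain_prod_conj (eq_map (permE inj_X)).
by rewrite map_tnth_enum -szs chain_prod_block_mask.
Qed.

(** * Traces on spaces of intertwiners *)

(** The map [A |-> P *m A *m Q] is a tensor product: its diagonal entry at [(i, j)] is
    [P i i * Q j j]. *)
Lemma mxtrace_lin_mul (F : fieldType) m n (P : 'M[F]_m) (Q : 'M[F]_n) :
  \tr (lin_mulmx P *m lin_mulmxr Q) = \tr P * \tr Q.
Proof.
rewrite /mxtrace (reindex (uncurry (@mxvec_index m n))) /=; last exact: curry_mxvec_bij.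
rewrite big_distrl /= (eq_bigr _ (fun i _ => big_distrr _ _ _)) /= pair_bigA /=.
apply: eq_bigr => -[i j] _ /=.
set L := _ *m _; have -> : L (mxvec_index i j) (mxvec_index i j)
    = (mxvec (delta_mx i j) *m L) 0 (mxvec_index i j).
  by rewrite mxvec_delta -rowE [RHS]mxE.
rewrite mulmxA !mul_vec_lin /= mxvecE !mxE (bigD1 j) //= big1 ?addr0.
  rewrite !mxE (bigD1 i) //= big1 ?addr0 ?mxE ?eqxx ?mulr1 // => k ki.
  by rewrite !mxE (negPf ki) mulr0.
move=> k kj; rewrite !mxE big1 ?mul0r // => t _.
by rewrite !mxE (negPf kj) andbF mulr0.
Qed.

(** Write [L = C *m B]. Since [B] is free, [B *m C *m B = Y *m B] gives [Y = B *m C], which has the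
    trace of [C *m B]. *)
Lemma mxtrace_restrict (F : fieldType) m n (B : 'M[F]_(m, n)) (L : 'M[F]_n)
    (Y : 'M[F]_m) :
  row_free B -> (L <= B)%MS -> B *m L = Y *m B -> \tr Y = \tr L.
Proof.
move=> freeB /submxP[C ->] BL; rewrite mxtrace_mulC; congr (\tr _).
by apply: (row_free_inj freeB); rewrite /= -BL mulmxA.
Qed.

Section HomTrace.
Variables (F : fieldType) (gT : finGroupType) (d1 d2 : nat).
Variables (r1 : mx_representation F [set: gT] d1).
Variables (r2 : mx_representation F [set: gT] d2).
Hypothesis cardG : #|gT|%:R != 0 :> F.

Definition intertwines (A : 'M[F]_(d1, d2)) := forall g, r1 g *m A = A *m r2 g.

Lemma intertwines_sum A : intertwines (\sum_g r1 g^-1%g *m A *m r2 g).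
Proof.
move=> h; rewrite mulmx_sumr mulmx_suml (reindex_inj (mulIg h)) /=.
apply: eq_bigr => g _; rewrite !mulmxA -repr_mxM ?inE // invMg mulKVg.
by rewrite repr_mxM ?inE // mulmxA.
Qed.

(* Right multiplication by K has on the space of intertwiners the same trace as
   its composite with the projection A |-> |G|^-1 sum_g r1(g)^-1 A r2(g) has on
   all matrices. *)
Lemma mxtrace_hom m (B : 'M[F]_(m, d1 * d2)) (K : 'M[F]_d2) (Y : 'M[F]_m) :
    row_free B ->
    (forall A, intertwines A <-> (mxvec A <= B)%MS) ->
    (forall g, K *m r2 g = r2 g *m K) ->
    B *m lin_mulmxr K = Y *m B ->
  \tr Y = #|gT|%:R^-1 * \sum_g \tr (r1 g^-1%g) * \tr (K *m r2 g).
Proof.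
move=> freeB BP Kr2 BK.
pose L := #|gT|%:R^-1 *:
  \sum_g lin_mulmx (r1 g^-1%g) *m lin_mulmxr (K *m r2 g) : 'M[F]_(d1 * d2).
have LE A : mxvec A *m L
    = mxvec (#|gT|%:R^-1 *: \sum_g r1 g^-1%g *m (A *m K) *m r2 g).
  rewrite /L -scalemxAr mulmx_sumr. rewrite [RHS]linearZ /= [in RHS]linear_sum /=. congr (_ *: _).
  by apply: eq_bigr => g _; rewrite mulmxA !mul_vec_lin /= !mulmxA.
have -> : \tr Y = \tr L.
  apply: (mxtrace_restrict freeB); last first.
    rewrite -BK; apply/row_matrixP => i; rewrite !row_mul.
    have := row_sub i B; rewrite -(vec_mxK (row i B)) => /BP Ai.
    rewrite LE mul_vec_lin /=; congr mxvec; set A := vec_mx _ in Ai *.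
    rewrite (eq_bigr (fun=> A *m K)) => [|g _].
      by rewrite sumr_const -scaler_nat scalerA mulVf ?scale1r.
    rewrite -mulmxA -mulmxA Kr2 (mulmxA A) -Ai !mulmxA -repr_mxM ?inE //.
    by rewrite mulVg repr_mx1 mul1mx.
  apply/row_subP => i; rewrite rowE -(vec_mxK (delta_mx 0 i)) LE; apply/BP => g.
  by rewrite -scalemxAr intertwines_sum scalemxAl.
rewrite linearZ /= linear_sum /=; congr (_ * _).
by apply: eq_bigr => g _; rewrite mxtrace_lin_mul.
Qed.

End HomTrace.

(* P only has to fix the image of every intertwiner; taking it to be a
   projector cuts rla down to the isotypic part that contributes. *)
Lemma skew_char_eq (F : fieldType) l k dmu dla
    (rmu : mx_representation F [set: 'S_l] dmu)
    (rla : mx_representation F [set: 'S_(l + k)] dla)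
    (r2 : mx_representation F [set: 'S_l] dla) (P : 'M[F]_dla) (s : 'S_k) :
    #|'S_l|%:R != 0 :> F ->
    (forall g, r2 g = rla (emb_first k g)) ->
    (forall g, P *m r2 g = r2 g *m P) ->
    (forall A, intertwines rmu r2 A -> A *m P = A) ->
  skew_char rmu rla s
  = #|'S_l|%:R^-1 * \sum_g \tr (rmu g^-1%g)
      * \tr (P *m rla (emb_first k g * emb_last l s)%g).
Proof.
move=> cardS r2E Pr2 AP; set K := rla (emb_last l s) *m P.
have rlaC g : rla (emb_last l s) *m r2 g = r2 g *m rla (emb_last l s).
  by rewrite r2E -!repr_mxM ?inE // emb_comm.
have Kr2 g : K *m r2 g = r2 g *m K.
  by rewrite /K -mulmxA Pr2 mulmxA rlaC mulmxA.
have HP A : intertwines rmu r2 A <-> (mxvec A <= row_base (hom_space rmu rla))%MS.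
  rewrite eq_row_base; split=> [HA|/hom_spaceP HA g]; last by rewrite HA r2E.
  by apply/hom_spaceP => g; rewrite HA r2E.
rewrite /skew_char (mxtrace_hom cardS (row_base_free _) HP Kr2); last first.
  transitivity (row_base (hom_space rmu rla) *m postcomp_mx dmu rla s).
    apply/row_matrixP => i; rewrite [LHS]row_mul [RHS]row_mul.
    have := row_sub i (row_base (hom_space rmu rla)).
    rewrite -(vec_mxK (row i _)) => /HP Ai. rewrite /postcomp_mx !mul_vec_lin /=.
    congr mxvec; rewrite /K mulmxA AP // => g.
    by rewrite mulmxA Ai -!mulmxA rlaC.
  have := val_submodJ (hom_space_module rmu rla) 1%:M (in_setT s).
  by rewrite /val_submod /= !mul1mx => <-.
congr (_ * _); apply: eq_bigr => g _; congr (_ * _).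
by rewrite /K -mulmxA mxtrace_mulC -mulmxA r2E -repr_mxM ?inE.
Qed.

(* By Schur's lemma the last hypothesis makes every intertwiner scalar, so the
   averaging projection has trace 1. *)
Lemma char_norm1 (F : fieldType) (gT : finGroupType) d
    (r : mx_representation F [set: gT] d) (v : 'rV[F]_d) :
    #|gT|%:R != 0 :> F -> mx_irreducible r -> v != 0 ->
    (forall A, intertwines r r A -> exists a, v *m A = a *: v) ->
  #|gT|%:R^-1 * \sum_g \tr (r g^-1%g) * \tr (r g) = 1.
Proof.
move=> cardG irr_r v0 vP.
have oneN0 : mxvec (1%:M : 'M[F]_d) != 0.
  rewrite mxvec_eq0; apply: contraNneq v0 => e.
  by rewrite -[v]mulmx1 e mulmx0.
transitivity (\tr (1%:M : 'M[F]_1)); last by rewrite mxtrace1.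
rewrite (@mxtrace_hom _ _ _ _ r r cardG 1 (mxvec 1%:M) 1%:M).
- by congr (_ * _); apply: eq_bigr => g _; rewrite mul1mx.
- by rewrite /row_free rank_rV oneN0.
- move=> A; split=> [HA|/submxP[C /(congr1 vec_mx)]]; last first.
    rewrite mxvecK [C]mx11_scalar mul_scalar_mx linearZ /= mxvecK => -> g.
    by rewrite -scalemxAr -scalemxAl mulmx1 mul1mx.
  have [a va] := vP A HA.
  have cA : centgmx r (A - a%:M).
    by apply/centgmxP => g _; rewrite mulmxBl mulmxBr HA scalar_mxC.
  have : A - a%:M == 0.
    (* The nonzero vector [v] is killed by [A - a%:M], which is therefore not invertible. *)
    apply: contraNT v0 => /(mx_Schur irr_r cA) Au.
    rewrite -(mulmxK Au v) mulmxBr va mul_mx_scalar subrr mul0mx //.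
  rewrite subr_eq0 => /eqP ->; rewrite -scalemx1 linearZ /=; exact: scalemx_sub.
- by move=> g; rewrite mul1mx mulmx1.
- by rewrite mul1mx mul_vec_lin /= mulmx1.
Qed.

(** * Standard tableaux as growth sequences *)

Lemma youngP (D : diagram) :
  reflect (forall i j, (i, j) \in D -> (i.-1, j) \in D /\ (i, j.-1) \in D)
          (young D).
Proof.
apply: (iffP forallP) => [yD i j ijD | yD [[i j] ijD]].
  by have /= /andP[] := yD [` ijD].
by have [/= -> ->] := yD i j ijD.
Qed.

Lemma young_le (D : diagram) i j i' j' : young D -> (i, j) \in D ->
  (i' <= i)%N -> (j' <= j)%N -> (i', j') \in D.
Proof.
move=> /youngP yD ijD i'i j'j; rewrite -(subKn i'i) -(subKn j'j).
elim: (i - i')%N => [|p IHp]; last by rewrite subnS; case: (yD _ _ IHp).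
elim: (j - j')%N => [|p IHp]; first by rewrite !subn0.
by rewrite subnS; case: (yD _ _ IHp).
Qed.

Lemma young_fset0 : young fset0.
Proof. by apply/youngP => i j; rewrite inE. Qed.

Definition addable (D : diagram) (b : box) : bool :=
  (b \notin D) && young (b |` D).

Lemma content_eq (b b' : box) :
  (content b == content b') = (b.2 + b'.1 == b'.2 + b.1)%N.
Proof. by rewrite /content subr_eq addrAC eq_sym subr_eq eq_sym -!PoszD eqz_nat. Qed.

(** Of two distinct boxes on a diagonal one lies to the upper left of the other, so adding the lower
    one to [D] requires the upper one to be in [D] already. *)
Lemma addable_content_inj D b b' :
  addable D b -> addable D b' -> content b = content b' -> b = b'.
Proof.
wlog le_bb' : b b' / (b.1 <= b'.1)%N.
  move=> W ab ab' cc; case: (leqP b.1 b'.1) => [/W->|/ltnW /W Wb] //.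
  by rewrite Wb.
case: b b' le_bb' => [i j] [i' j'] /= ii' /andP[ijD _] /andP[ijD' y'] /eqP.
rewrite content_eq /= => /eqP cc.
have : (i, j) \in (i', j') |` D.
  apply: (young_le y' (fset1U1 _ _) ii').
  by rewrite -(leq_add2r i) -cc leq_add2l.
by rewrite !inE (negPf ijD) orbF => /eqP.
Qed.

Definition grow (D : diagram) (bs : seq box) : diagram :=
  foldl (fun D b => b |` D) D bs.

Fixpoint is_growth (D : diagram) (bs : seq box) : bool :=
  if bs is b :: bs' then addable D b && is_growth (b |` D) bs' else true.

(** An explicit list makes sums unfold at the first box. The set [U] only supplies finitely many
    candidate boxes: by [growths_univ] every [U] containing [E] gives the same growths. *)
Fixpoint growths (U E D : diagram) (m : nat) : seq (seq box) :=
  if m is m'.+1 then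
    flatten [seq map (cons b) (growths U E (b |` D) m')
            | b <- enum_fset U & addable D b]
  else if D == E then [:: [::]] else [::].

Lemma in_grow D bs x : (x \in grow D bs) = (x \in bs) || (x \in D).
Proof. by elim: bs D => //= b bs IHbs D; rewrite IHbs !inE orbCA orbA. Qed.

Lemma grow_cat D bs bs' : grow D (bs ++ bs') = grow (grow D bs) bs'.
Proof. exact: foldl_cat. Qed.

Lemma is_growth_cat D bs bs' :
  is_growth D (bs ++ bs') = is_growth D bs && is_growth (grow D bs) bs'.
Proof. by elim: bs D => //= b bs IHbs D; rewrite IHbs andbA. Qed.

Lemma young_grow D bs : young D -> is_growth D bs -> young (grow D bs).
Proof. by elim: bs D => //= b bs IHbs D yD /andP[/andP[_ yb] /IHbs]; apply. Qed.

Lemma growth_uniq D bs : is_growth D bs -> uniq bs && all (fun b => b \notin D) bs.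
Proof.
elim: bs D => //= b bs IHbs D /andP[/andP[bD _] /IHbs /andP[-> bsD]].
rewrite bD andbT; apply/andP; split.
  by apply/negP => /(allP bsD); rewrite fset1U1.
by apply/allP => x /(allP bsD); rewrite !inE negb_or => /andP[].
Qed.

Lemma is_growthP D bs :
  reflect (forall p b q, bs = p ++ b :: q -> addable (grow D p) b)
          (is_growth D bs).
Proof.
apply: (iffP idP) => [gbs p b q bsE|H].
  by move: gbs; rewrite bsE is_growth_cat /= => /and3P[].
elim: bs D H => //= b bs IHbs D H; rewrite (H [::] b bs) //=.
by apply: IHbs => p b' q bsE; apply: (H (b :: p) b' q); rewrite bsE.
Qed.

Lemma mem_growths U E D m bs :
  (bs \in growths U E D m)
  = [&& size bs == m, all (fun b => b \in U) bs, is_growth D bs & grow D bs == E].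
Proof.
elim: m D bs => [|m IHm] D bs.
  by case: bs => [|b bs] /=; case: ifP.
apply/flattenP/idP => [[_ /mapP[b b_in ->]] /mapP[bs' bs'_in ->]|].
  move: b_in bs'_in; rewrite mem_filter IHm => /andP[ab bU] /and4P[/eqP <- bsU g e].
  by rewrite /= eqxx ab g e bsU !andbT; apply: bU.
case: bs => [|b bs] //= /and4P[sz /andP[bU bsU] /andP[ab gbs] e].
exists (map (cons b) (growths U E (b |` D) m)).
  by apply/mapP; exists b => //; rewrite mem_filter ab.
by apply: map_f; rewrite IHm -eqSS sz bsU gbs e.
Qed.

Lemma uniq_growths U E D m : uniq (growths U E D m).
Proof.
elim: m D => [|m IHm] D /=; first by case: ifP.
have: uniq [seq b <- enum_fset U | addable D b] by rewrite filter_uniq ?fset_uniq.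
elim: [seq b <- _ | _] => //= b s IHs /andP[b_s /IHs u].
rewrite cat_uniq u andbT map_inj_uniq ?IHm //=; last by move=> ? ? [].
apply/hasPn => bs /flattenP[_ /mapP[b' b's ->]] /mapP[bs' _ ->].
by apply/mapP => -[bs'' _ [e _]]; rewrite -e b's in b_s.
Qed.

Lemma growths_univ U E D m : E `<=` U ->
  perm_eq (growths E E D m) (growths U E D m).
Proof.
move=> /fsubsetP EU; apply: uniq_perm; rewrite ?uniq_growths // => bs.
rewrite !mem_growths; case: eqP => //= _.
case: (altP (grow D bs =P E)) => [gE|_]; last by rewrite !andbF.
have bE b : b \in bs -> b \in E by move=> b_in; rewrite -gE in_grow b_in.
by congr (_ && _); apply/allP/allP => _ b /bE // /EU.
Qed.

(** Each content singles out the next box, by [addable_content_inj]. This is the simplicity of the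
    joint spectrum of the Jucys-Murphy elements. *)
Lemma growth_content_inj D bs bs' : is_growth D bs -> is_growth D bs' ->
  map content bs = map content bs' -> bs = bs'.
Proof.
elim: bs bs' D => [|b bs IHbs] [|b' bs'] //= D /andP[ab gbs] /andP[ab' gbs'] [cb cbs].
have bb' := addable_content_inj ab ab' cb; rewrite -bb' in gbs' *.
by rewrite (IHbs _ _ gbs gbs' cbs).
Qed.

Lemma big_growthsS (V : nmodType) (f : seq box -> V) U E D m :
  \sum_(bs <- growths U E D m.+1) f bs
  = \sum_(b <- enum_fset U | addable D b)
      \sum_(bs <- growths U E (b |` D) m) f (b :: bs).
Proof.
rewrite /= big_flatten /= big_map big_filter; apply: eq_bigr => b _.
by rewrite big_map.
Qed.

(** Every growth passes through exactly one diagram [E] after [p] boxes, and its two halves vary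
    independently once [E] is fixed. *)
Lemma big_growths_cat (V : nmodType) (f : seq box -> seq box -> V) la D p q :
    young D -> D `<=` la ->
  \sum_(bs <- growths la la D (p + q)) f (take p bs) (drop p bs)
  = \sum_(E : fpowerset la | young (val E))
      \sum_(bs1 <- growths la (val E) D p)
        \sum_(bs2 <- growths la la (val E) q) f bs1 bs2.
Proof.
elim: p f D => [|p IHp] f D yD Dla.
  have D_in : D \in fpowerset la by rewrite fpowersetE.
  rewrite add0n (bigD1 [` D_in]) /= ?yD // eqxx big_seq1 [X in (_ + X)%R]big1 ?addr0.
    by apply: eq_bigr => bs _; rewrite take0 drop0.
  move=> E /andP[_ ED]; case: eqP => [DE|_]; last by rewrite big_nil.
  by case/eqP: ED; apply: val_inj.
rewrite addSn big_growthsS.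
rewrite [RHS](eq_bigr _ (fun E _ => big_growthsS _ _ _ _ _)) [RHS]exchange_big /=.
rewrite big_seq_cond [RHS]big_seq_cond; apply: eq_bigr => b /andP[bla /andP[_ yb]].
rewrite (IHp (fun bs1 bs2 => f (b :: bs1) bs2)) // fsubUset fsub1set Dla.
by rewrite andbT; apply: bla.
Qed.

Section Tableaux.
Variables (n : nat) (la : diagram).
Hypotheses (yla : young la) (sz_la : #|` la| = n).

Definition boxes (T : {ffun 'I_n -> la}) : seq box :=
  [seq val (T i) | i <- enum 'I_n].

Lemma size_boxes T : size (boxes T) = n.
Proof. by rewrite size_map size_enum_ord. Qed.

Lemma nth_boxes T (i : 'I_n) x0 : nth x0 (boxes T) i = val (T i).
Proof. by rewrite (nth_map i) ?size_enum_ord // nth_ord_enum. Qed.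

Lemma boxes_inj : injective boxes.
Proof.
move=> T T' eqTT'; apply/ffunP => i; apply: val_inj.
by rewrite -(nth_boxes T i (0, 0)%N) -(nth_boxes T' i (0, 0)%N) eqTT'.
Qed.

(** Boxes sharing a row or a column with [T i] suffice for [boxes_growth], since [youngP] asks only
    for the upper and left neighbours. *)
Lemma standard_le (T : {ffun 'I_n -> la}) i b : standard T -> b \in la ->
    (b.1 <= (val (T i)).1)%N -> (b.2 <= (val (T i)).2)%N ->
    (b.1 == (val (T i)).1) || (b.2 == (val (T i)).2) ->
  exists2 j : 'I_n, b = val (T j) & (j <= i)%N.
Proof.
case/and4P=> _ /forallP surj /forallP rowT /forallP colT bla le1 le2 eq12.
case: (altP (b =P val (T i))) => [->|neq]; first by exists i.
have /codomP[j bE] := surj [` bla].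
have {}bE : b = val (T j) by rewrite -bE.
exists j => //; rewrite {}bE in le1 le2 eq12 neq.
apply: ltnW; case/orP: eq12 => e.
  have /forallP/(_ i)/implyP := rowT j; apply; rewrite /row_of /col_of e /=.
  rewrite ltn_neqAle le2 andbT; apply: contraNneq neq => e2.
  by rewrite -pair_eqE; apply/andP; split=> //; apply/eqP.
have /forallP/(_ i)/implyP := colT j; apply; rewrite /row_of /col_of e /=.
rewrite ltn_neqAle le1 andbT; apply: contraNneq neq => e1.
by rewrite -pair_eqE; apply/andP; split=> //; apply/eqP.
Qed.

Lemma mem_take_boxes (T : {ffun 'I_n -> la}) i b :
  reflect (exists2 j : 'I_n, b = val (T j) & (j < i)%N) (b \in take i (boxes T)).
Proof.
have takeP (j : 'I_n) : (j \in take i (enum 'I_n)) = (j < i)%N.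
  rewrite -(mem_map val_inj) map_take val_enum_ord take_iota mem_iota /=.
  by rewrite add0n leq_min ltn_ord andbT.
rewrite /boxes -map_take; apply: (iffP mapP) => -[j].
  by rewrite takeP => ji ->; exists j.
by move=> -> ji; exists j; rewrite ?takeP.
Qed.

Lemma boxes_growth (T : {ffun 'I_n -> la}) :
  standard T -> is_growth fset0 (boxes T) && (grow fset0 (boxes T) == la).
Proof.
move=> stT; apply/andP; split; last first.
  apply/eqP/fsetP => b; rewrite in_grow inE orbF; apply/mapP/idP => [[i _ ->]|bla].
    exact: valP.
  case/and4P: stT => _ /forallP /(_ [` bla]) /codomP[i bE] _ _.
  by exists i; rewrite ?mem_enum // -bE.
apply/is_growthP => p b q TE.
have lt_pn : (size p < n)%N.
  by rewrite -(size_boxes T) TE size_cat /= addnS ltnS leq_addr.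
pose i := Ordinal lt_pn.
have bE : b = val (T i) by rewrite -(nth_boxes T i b) TE /= nth_cat ltnn subnn.
have pE : take i (boxes T) = p by rewrite TE take_size_cat.
have pbE : take i.+1 (boxes T) = rcons p b.
  by rewrite TE -cat_rcons take_size_cat // size_rcons.
have in_pb x : (x \in b |` grow fset0 p) = (x \in take i.+1 (boxes T)).
  by rewrite pbE mem_rcons !inE in_grow inE orbF.
apply/andP; split.
  rewrite in_grow inE orbF -pE; apply/mem_take_boxes => -[j].
  rewrite bE => /val_inj Tij; case/and4P: stT => /injectiveP /(_ _ _ Tij) <- _ _ _.
  by rewrite ltnn.
apply/youngP => r c; rewrite !in_pb => /mem_take_boxes[j rcE ji].
have /(youngP _ yla)[r_in c_in] : (r, c) \in la by rewrite rcE; apply: valP.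
split; apply/mem_take_boxes.
  case: (@standard_le T j _ stT r_in) => [||| j' -> j'j];
    rewrite -?rcE ?leq_pred ?eqxx ?orbT //.
  by exists j' => //; apply: leq_ltn_trans ji.
case: (@standard_le T j _ stT c_in) => [||| j' -> j'j];
  rewrite -?rcE ?leq_pred ?eqxx ?orbT //.
by exists j' => //; apply: leq_ltn_trans ji.
Qed.

Lemma growth_boxes bs :
  is_growth fset0 bs -> grow fset0 bs = la ->
  exists2 T : {ffun 'I_n -> la}, standard T & boxes T = bs.
Proof.
move=> gbs bs_la; have /andP[ubs _] := growth_uniq gbs.
have mem_bs x : (x \in bs) = (x \in la) by rewrite -bs_la in_grow inE orbF.
have sz_bs : size bs = n.
  by rewrite -sz_la; apply: perm_size; apply: uniq_perm; rewrite ?fset_uniq.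
have bs_in (i : 'I_n) : nth (0, 0)%N bs i \in la.
  by rewrite -mem_bs mem_nth // sz_bs.
pose T := [ffun i : 'I_n => [` bs_in i] : la].
have TE i : val (T i) = nth (0, 0)%N bs i by rewrite ffunE.
have bE : boxes T = bs.
  apply: (@eq_from_nth _ (0, 0)%N) => [|i]; rewrite size_boxes // => lt_in.
  by rewrite (nth_boxes T (Ordinal lt_in)) TE.
have young_take p : young (grow fset0 (take p bs)).
  apply: young_grow young_fset0 _; move: gbs.
  by rewrite -{1}(cat_take_drop p bs) is_growth_cat => /andP[].
have injT : injective T.
  move=> i j /(congr1 val); rewrite !TE => /eqP.
  by rewrite nth_uniq ?sz_bs // => /eqP/val_inj.
(* The boxes up to [T j] form a Young diagram, which contains everything to the upper left of
   [T j]. *)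
have lt_T i j : ((val (T i)).1 <= (val (T j)).1)%N -> ((val (T i)).2 <= (val (T j)).2)%N ->
    T i != T j -> (i < j)%N.
  move=> le1 le2 neq; rewrite ltn_neqAle; apply/andP; split.
    by apply: contraNneq neq => /val_inj ->.
  have : val (T i) \in grow fset0 (take j.+1 bs).
    rewrite [val (T i)]surjective_pairing.
    apply: (young_le (young_take j.+1) _ le1 le2).
    rewrite -surjective_pairing in_grow inE orbF -bE.
    by apply/mem_take_boxes; exists j.
  rewrite in_grow inE orbF -bE => /mem_take_boxes[i' /val_inj/injT <-].
  by rewrite ltnS.
exists T => //; apply/and4P; split; first exact/injectiveP.
- apply/forallP => b; have : val b \in bs by rewrite mem_bs; apply: valP.
  rewrite -bE => /mapP[i _ bi]; apply/codomP; exists i; exact: val_inj.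
- apply/forallP => i; apply/forallP => j; apply/implyP => /andP[/eqP e lt].
  apply: lt_T; rewrite ?(ltnW lt) //; first exact: eq_leq e.
  by apply: contraTneq lt => ->; rewrite ltnn.
- apply/forallP => i; apply/forallP => j; apply/implyP => /andP[/eqP e lt].
  apply: lt_T; rewrite ?(ltnW lt) //; first exact: eq_leq e.
  by apply: contraTneq lt => ->; rewrite ltnn.
Qed.

Lemma perm_boxes :
  perm_eq [seq boxes (val T) | T : syt n la] (growths la la fset0 n).
Proof.
apply: uniq_perm; rewrite ?uniq_growths //.
  by rewrite map_inj_uniq ?enum_uniq // => T T' /boxes_inj/val_inj.
move=> bs; rewrite mem_growths; apply/mapP/idP => [[T _ ->]|].
  have /andP[gT gE] := boxes_growth (valP T).
  rewrite size_boxes eqxx gT gE !andbT; apply/allP => b b_in.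
  by rewrite -(eqP gE) in_grow b_in.
case/and4P=> _ _ /growth_boxes gT /eqP /gT[T stT <-].
by exists (exist _ T stT); rewrite ?mem_enum.
Qed.

End Tableaux.

(** * Partial fractions *)

Lemma horner_prod_XsubC (F : fieldType) (s : seq F) u :
  (\prod_(c <- s) ('X - c%:P)).[u] = \prod_(c <- s) (u - c).
Proof. by rewrite horner_prod; apply: eq_bigr => c _; rewrite hornerXsubC. Qed.

Section Lagrange.
Variables (F : fieldType) (N : {poly F}) (s : seq F).
Hypotheses (us : uniq s) (szN : (size N <= size s)%N).

Definition residue (c : F) : F := N.[c] / \prod_(c' <- rem c s) (c - c').

(** The difference of the two sides has size at most [size s] and vanishes at every point of [s]. *)
Lemma lagrange_expansion :
  N = \sum_(c <- s) residue c *: \prod_(c' <- rem c s) ('X - c'%:P).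
Proof.
apply/eqP; rewrite -subr_eq0; apply/eqP; apply: (@roots_geq_poly_eq0 _ _ s) => //.
  apply/allP => c cs; rewrite /root hornerD hornerN horner_sum (bigD1_seq c) //=.
  rewrite hornerZ horner_prod_XsubC [X in _ - (_ + X)]big1 ?addr0 => [|c' c'c].
    rewrite /residue divfK ?subrr // prodf_seq_neq0; apply/allP => c'.
    by rewrite mem_rem_uniq // inE subr_eq0 eq_sym => /andP[].
  have c_in : c \in rem c' s by rewrite mem_rem_uniq // !inE eq_sym c'c.
  rewrite hornerZ horner_prod_XsubC (bigD1_seq c) ?rem_uniq //=.
  by rewrite subrr mul0r mulr0.
apply: leq_trans (size_polyD _ _) _; rewrite geq_max szN size_polyN.
apply: leq_trans (size_sum _ _ _) _; apply/bigmax_leqP_seq => c cs _.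
apply: leq_trans (size_scale_leq _ _) _; rewrite size_prod_XsubC size_rem //.
by case: (s) cs.
Qed.

Lemma partial_fractions u : u \notin s ->
  N.[u] / \prod_(c <- s) (u - c) = \sum_(c <- s) residue c / (u - c).
Proof.
move=> u_s; rewrite [in LHS]lagrange_expansion horner_sum mulr_suml.
rewrite big_seq [RHS]big_seq; apply: eq_bigr => c cs.
rewrite hornerZ horner_prod_XsubC (perm_big _ (perm_to_rem cs)) big_cons /=.
rewrite -mulrA; congr (_ * _); rewrite mulrC invfM divfK //.
rewrite prodf_seq_neq0; apply/allP => c' /mem_rem c's.
by rewrite subr_eq0; apply: contraNneq u_s => ->.
Qed.

(** Compare top coefficients in the Lagrange expansion, where each product is monic of degree
    [(size s).-1]. This is the coefficient at infinity. *)
Lemma sum_residue : \sum_(c <- s) residue c = N`_(size s).-1.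
Proof.
rewrite [in RHS]lagrange_expansion coef_sum big_seq [RHS]big_seq.
apply: eq_bigr => c cs; rewrite coefZ.
have /monicP := monic_prod_XsubC (rem c s) xpredT id.
by rewrite /lead_coef size_prod_XsubC size_rem //= => ->; rewrite mulr1.
Qed.

End Lagrange.

(** * Neighbours and diagonals in convex sets of boxes *)

Section SkewDiagram.
Variable S : diagram.

(** The test [0 < x.1] excludes the truncated predecessor, which would make a box of the first row
    its own upper neighbour. The same holds for [left] and [upleft]. *)
Definition up (x : box) : bool := (0 < x.1)%N && ((x.1.-1, x.2) \in S).
Definition left (x : box) : bool := (0 < x.2)%N && ((x.1, x.2.-1) \in S).
Definition right (x : box) : bool := (x.1, x.2.+1) \in S.
Definition upleft (x : box) : bool :=
  [&& 0 < x.1, 0 < x.2 & (x.1.-1, x.2.-1) \in S]%N.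
Definition initial (x : box) : bool := ~~ up x && ~~ left x.

(** This is order convexity for the product order on boxes; differences of Young diagrams have it by
    [skew_convex]. *)
Definition convex : Prop := forall a b x y i j, (a, b) \in S -> (x, y) \in S ->
  (a <= i <= x)%N -> (b <= j <= y)%N -> (i, j) \in S.

Hypothesis convS : convex.

Lemma upleft_up x : x \in S -> upleft x -> up x.
Proof.
case: x => i j xS /and3P[i0 j0 ulS]; rewrite /up i0 /=.
by apply: (convS ulS xS); rewrite /= ?leqnn ?leq_pred.
Qed.

Lemma upleft_left x : x \in S -> upleft x -> left x.
Proof.
case: x => i j xS /and3P[i0 j0 ulS]; rewrite /left j0 /=.
by apply: (convS ulS xS); rewrite /= ?leqnn ?leq_pred.
Qed.

(** The box [y] and its left, upper and upper left neighbours all lie in the rectangle spanned by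
    [x] and [y]. *)
Lemma content_lt_up x y : x \in S -> y \in S -> content x = content y ->
  (x.1 < y.1)%N -> [/\ up y, left y & upleft y].
Proof.
case: x y => [a b] [i j] /= xS yS /eqP; rewrite content_eq /= => /eqP cc ai.
have i0 : (0 < i)%N by apply: leq_ltn_trans ai.
have bj : (b < j)%N by rewrite -(ltn_add2r i) cc ltn_add2l.
have j0 : (0 < j)%N by apply: leq_ltn_trans bj.
have ai' : (a <= i.-1)%N by rewrite -ltnS prednK.
have bj' : (b <= j.-1)%N by rewrite -ltnS prednK.
rewrite /up /left /upleft /= i0 j0 /=; split; apply: (convS xS yS);
  by rewrite ?leq_pred ?leqnn ?ai' ?bj' ?(ltnW ai) ?(ltnW bj).
Qed.

Lemma content_eq_row (x y : box) : content x = content y -> x.1 = y.1 -> x = y.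
Proof.
case: x y => [a b] [i j] /eqP; rewrite content_eq /= => /eqP cc ai.
by move: cc; rewrite ai => /addIn ->.
Qed.

Lemma initial_content_inj x y : x \in S -> y \in S -> initial x -> initial y ->
  content x = content y -> x = y.
Proof.
move=> xS yS /andP[ux _] /andP[uy _] cc.
case: (ltngtP x.1 y.1) => [lt|lt|]; last exact: content_eq_row.
  by have [] := content_lt_up xS yS cc lt; rewrite (negPf uy).
by have [] := content_lt_up yS xS (esym cc) lt; rewrite (negPf ux).
Qed.

End SkewDiagram.

(** * Greene's identity for skew diagrams *)

Section Greene.
Variable F : numFieldType.
Local Notation ct b := ((content b)%:~R : F).

(** The starting point [u] is kept free as the variable of the partial fractions. Started at its own
    first content, a walk has the weight of a fully linked chain. *)
Fixpoint walk_wt (u : F) (c : seq F) : F :=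
  if c is x :: c' then (x - u)^-1 * walk_wt x c' else 1.

Lemma contentB (x b : box) : ct b - ct x = (content b - content x)%:~R.
Proof. by rewrite -intrB. Qed.

Lemma content_inj_eq (x y : box) : (ct x == ct y) = (content x == content y).
Proof. by rewrite eqr_int. Qed.

Section Factors.
Variable S : diagram.

(** This is the numerator of the factor of [x], as a polynomial in [u]. The poles, which occur at
    initial boxes only, are split off in [box_wt], so that partial fractions apply to the product
    over [S]. *)
Definition box_poly (x : box) : {poly F} :=
  if upleft S x then 0
  else if left S x then (if up S x then 'X - (ct x)%:P else 1) else -1.

Definition box_wt (u : F) (x : box) : F :=
  (box_poly x).[u] * (if initial S x then (u - ct x)^-1 else 1).

End Factors.

Lemma up_del (S : diagram) (b x : box) : x != (b.1.+1, b.2) ->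
  up (S `\ b) x = up S x.
Proof.
case: b x => i j [r c] /= neq; rewrite /up /= !inE; case: r neq => [|r] //=.
by rewrite !xpair_eqE eqSS => /negPf ->.
Qed.

Lemma left_del (S : diagram) (b x : box) : x != (b.1, b.2.+1) ->
  left (S `\ b) x = left S x.
Proof.
case: b x => i j [r c] /= neq; rewrite /left /= !inE; case: c neq => [|c] //=.
by rewrite !xpair_eqE eqSS => /negPf ->.
Qed.

Lemma upleft_del (S : diagram) (b x : box) : x != (b.1.+1, b.2.+1) ->
  upleft (S `\ b) x = upleft S x.
Proof.
case: b x => i j [r c] /= neq; rewrite /upleft /= !inE.
case: r c neq => [|r] [|c] //=.
by rewrite !xpair_eqE !eqSS => /negPf ->.
Qed.

(* This is the residue computation at u = ct b: only the right, lower and lower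
   right neighbours of b see b, and their weights agree there. *)
Lemma box_wt_del (S : diagram) (b x : box) : convex S ->
  b \in S -> initial S b -> x \in S -> x != b ->
  box_wt (S `\ b) (ct b) x = box_wt S (ct b) x.
Proof.
move=> convS bS /andP[ub lb] xS xb; rewrite /box_wt /box_poly /initial.
have del_nb y : y != b -> (y \in S `\ b) = (y \in S) by move=> yb; rewrite !inE yb.
case: (eqVneq x (b.1, b.2.+1)) => [xE|x_r].
  have ulx : upleft S x = false.
    by rewrite xE /upleft /=; apply: contraNF ub; rewrite /up => /andP[-> ->].
  have lx : left S x by rewrite xE /left /= -surjective_pairing.
  have lx' : left (S `\ b) x = false.
    by rewrite xE /left /= -surjective_pairing !inE eqxx.
  (* With an upper neighbour the factor is [ct b - ct x = -1] before and -1 after the removal of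
     [b]; without one it is 1 before and [- (ct b - ct x)^-1 = 1] after. *)
  have cbx : ct b - ct x = -1.
    rewrite contentB xE (_ : content b - _ = -1) //.
    by rewrite /content /row_of /col_of /=; lia.
  rewrite upleft_del ?up_del ?ulx ?lx ?lx' ?andbT ?andbF; last 2 first.
  - by rewrite xE; apply/eqP => -[]; lia.
  - by rewrite xE; apply/eqP => -[]; lia.
  by case: (up S x); rewrite !hornerE ?cbx ?invrN ?invr1 ?mulr1 ?mulrNN ?mulr1.
case: (eqVneq x (b.1.+1, b.2)) => [xE|x_d].
  have ulx : upleft S x = false.
    by rewrite xE /upleft /=; apply: contraNF lb; rewrite /left => /andP[-> ->].
  have ux : up S x by rewrite xE /up /= -surjective_pairing.
  have ux' : up (S `\ b) x = false.
    by rewrite xE /up /= -surjective_pairing !inE eqxx.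
  have cbx : ct b - ct x = 1.
    rewrite contentB xE (_ : content b - _ = 1) //.
    by rewrite /content /row_of /col_of /=; lia.
  rewrite upleft_del ?left_del ?ulx ?ux ?ux' ?andbT ?andbF //=; last first.
  - by rewrite xE; apply/eqP => -[]; lia.
  by case: (left S x); rewrite !hornerE ?cbx ?invr1 ?mulr1.
rewrite up_del // left_del //.
case: (eqVneq x (b.1.+1, b.2.+1)) => [xE|x_dr]; last by rewrite upleft_del.
(* The factor 0 becomes [ct b - ct x], which vanishes because [x] is on the diagonal of [b]. *)
have ulx : upleft S x by rewrite xE /upleft /= -surjective_pairing.
have ulx' : upleft (S `\ b) x = false.
  by rewrite xE /upleft /= -surjective_pairing !inE eqxx.
rewrite ulx ulx' (upleft_up convS xS ulx) (upleft_left convS xS ulx) /=.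
rewrite !hornerE contentB xE (_ : content b - _ = 0) //.
by rewrite /content /row_of /col_of /=; lia.
Qed.

(** This keeps [ct b] away from the poles of the product for [S] without [b]. A box above [b] on its
    diagonal would give [b] an upper neighbour; one below would have an upper neighbour, which is
    not [b] and so survives. *)
Lemma initial_del_content (S : diagram) b x : convex S -> b \in S -> initial S b ->
  x \in S `\ b -> initial (S `\ b) x -> content x != content b.
Proof.
move=> convS bS ib; rewrite !inE => /andP[xb xS] /andP[ux lx].
apply/eqP => cc; case: (ltngtP x.1 b.1) => [lt|lt|e].
- by have [] := content_lt_up convS xS bS cc lt; case/andP: ib => /negPf ->.
- have [] := content_lt_up convS bS xS (esym cc) lt.
  rewrite -(@up_del S b) ?(negPf ux) //; apply: contra xb => /eqP xE.
  by move: cc; rewrite xE /content /row_of /col_of /=; lia.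
- by case/eqP: xb; apply: content_eq_row.
Qed.

End Greene.

(** * Counting initial and inner boxes; connectedness and height *)

Section Counting.
Variable S : diagram.
Hypotheses (convS : convex S).

Definition inner (x : box) : bool := up S x && left S x.
(** The right and the upper neighbour are the adjacent boxes whose content is larger by 1. *)
Definition next_diag (x : box) : bool := right S x || up S x.

(** Inclusion-exclusion: the inner boxes are the intersection of [up] and [left], the initial ones
    the complement of the union. *)
Lemma count_inner_initial :
  (count inner S + size S = count (initial S) S + (count (left S) S + count (up S) S))%N.
Proof.
have := count_predUI (up S) (left S) S.
have := count_predC (predU (up S) (left S)) S.
have -> : count (predC (predU (up S) (left S))) S = count (initial S) S.
  by apply: eq_count => x /=; rewrite negb_or.
have -> : count (predI (up S) (left S)) S = count inner S by [].
move=> <- e; rewrite addnA (addnC (count inner S)) e addnC.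
by rewrite [(count (up S) S + _)%N]addnC.
Qed.

Lemma count_left_right : count (left S) S = count (right S) S.
Proof.
pose f (x : box) : box := (x.1, x.2.+1).
have inj_f : injective f by move=> [a b] [c d] [-> ->].
rewrite -!size_filter -(size_map f [seq x <- S | right S x]).
apply: perm_size; apply: uniq_perm.
- by rewrite filter_uniq ?fset_uniq.
- by rewrite (map_inj_uniq inj_f) filter_uniq ?fset_uniq.
move=> x; rewrite mem_filter; apply/andP/mapP => [[]|[y]].
  case: x => i [|j] // /andP[_ /= ijS] xS.
  by exists (i, j); rewrite // mem_filter /right /= xS ijS.
by rewrite mem_filter => /andP[ry yS] ->; rewrite /left /= -surjective_pairing.
Qed.

Lemma upleftP :
  reflect {in S &, injective content} (~~ has (upleft S) S).
Proof.
apply: (iffP idP) => [noul x y xS yS cc | inj].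
  case: (ltngtP x.1 y.1) => [lt|lt|]; last exact: content_eq_row.
    have [_ _ ul] := content_lt_up convS xS yS cc lt.
    by case/hasP: noul; exists y.
  have [_ _ ul] := content_lt_up convS yS xS (esym cc) lt.
  by case/hasP: noul; exists x.
apply/hasPn => -[i j] xS; apply/negP => /and3P[/= i0 j0 ulS].
have : (i.-1, j.-1) = (i, j).
  by apply: inj => //; rewrite /content /row_of /col_of /=; lia.
by case=> ei _; move: i0; rewrite -ei; lia.
Qed.

Lemma right_content x : content (x.1, x.2.+1) = content x + 1.
Proof. by rewrite /content /row_of /col_of /=; lia. Qed.

Lemma up_content x : (0 < x.1)%N -> content (x.1.-1, x.2) = content x + 1.
Proof. by rewrite /content /row_of /col_of /=; lia. Qed.

Lemma next_diagP x : next_diag x ->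
  exists y, [/\ y \in S, adjacent x y & content y = content x + 1].
Proof.
case/orP => [rS|/andP[x0 uS]].
  exists (x.1, x.2.+1); split=> //; last exact: right_content.
  by rewrite /adjacent /row_of /col_of /= !eqxx.
exists (x.1.-1, x.2); split=> //; last exact: up_content.
by rewrite /adjacent /row_of /col_of /= prednK // !eqxx !orbT.
Qed.

Lemma adjacent_next_diag x y : y \in S -> adjacent x y -> content x < content y ->
  next_diag x /\ content y = content x + 1.
Proof.
case: x y => [a b] [i j] yS; rewrite /adjacent /next_diag /right /up /row_of /col_of /=.
rewrite -!orbA => /or4P[] /andP[/eqP e1 /eqP e2];
  rewrite /content /row_of /col_of /= => lt.
- by rewrite e1 e2 yS; split=> //; lia.
- by exfalso; lia.
- by exfalso; lia.
- by rewrite -e2 /= e1 yS orbT; split=> //; lia.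
Qed.

Section Distinct.
Hypothesis inj_ct : {in S &, injective content}.

(** Shifting turns left neighbours into right ones; the right and the upper neighbour of a box share
    a content, so they cannot both be in [S]. *)
Lemma count_next_diag : (count (left S) S + count (up S) S = count next_diag S)%N.
Proof.
rewrite count_left_right; have := count_predUI (right S) (up S) S.
have -> : count (predI (right S) (up S)) S = 0%N.
  apply/eqP; rewrite -leqn0 leqNgt -has_count; apply/hasPn => x xS.
  apply/negP => /andP[rS /andP[x0 uS]].
  have : (x.1, x.2.+1) = (x.1.-1, x.2).
    by apply: inj_ct => //; rewrite right_content up_content.
  by case=> e _; move: x0; rewrite e; lia.
by rewrite addn0 => <-; apply: eq_count.
Qed.

Lemma last_box : S != fset0 ->
  exists2 y, y \in S & forall x, x \in S -> content x <= content y.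
Proof.
case/fset0Pn => x0 x0S.
case: (@Order.TotalTheory.arg_maxP _ _ S [` x0S] xpredT (fun x : S => content (val x))) => // y _ yP.
by exists (val y) => [|x xS]; [apply: valP | apply: (yP [` xS])].
Qed.

Lemma last_next_diag y : y \in S -> (forall x, x \in S -> content x <= content y) ->
  ~~ next_diag y.
Proof.
move=> yS max_y; apply/negP => /next_diagP[z [zS _ cz]].
by have := max_y _ zS; rewrite cz gerDl ler10.
Qed.

(** The number of initial boxes minus that of inner boxes counts the boxes failing [next_diag], and
    a box of largest content is one of these. *)
Lemma count_inner_lt : S != fset0 -> (count inner S < count (initial S) S)%N.
Proof.
move=> /last_box[y yS /(last_next_diag yS) ny].
have := count_inner_initial; rewrite count_next_diag.
have := count_predC next_diag S.
have : (0 < count (predC next_diag) S)%N by rewrite -has_count; apply/hasP; exists y.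
move: (count inner S) (count (initial S) S) (count next_diag S) 
  (count (predC next_diag) S) (size S) => a b c d e; lia.
Qed.

(** By the same count, the right-hand side says that the box [y] of largest content is the only one
    failing [next_diag], that is, that one can climb to [y] from everywhere. *)
Lemma connected_count : S != fset0 ->
  connected S = ((count inner S).+1 == count (initial S) S).
Proof.
move=> S0; have [y yS max_y] := last_box S0.
have ny := last_next_diag yS max_y.
have -> : ((count inner S).+1 == count (initial S) S)
    = (count (predC next_diag) S == 1%N).
  have := count_inner_initial; rewrite count_next_diag.
  have := count_predC next_diag S.
  move: (count inner S) (count (initial S) S) (count next_diag S)
    (count (predC next_diag) S) (size S) => a b c d e; lia.
have y_in : y \in [seq x <- S | predC next_diag x] by rewrite mem_filter /= ny.
have -> : (count (predC next_diag) S == 1%N)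
    = [forall x : S, (val x != y) ==> next_diag (val x)].
  rewrite -size_filter; apply/eqP/forallP => [sz1 x|H].
    apply/implyP; apply: contraNT => nx.
    have : val x \in [seq x <- S | predC next_diag x].
      by rewrite mem_filter /= nx; apply: valP.
    move: y_in; case: [seq _ <- _ | _] sz1 => [|z []] // _.
    by rewrite !inE => /eqP -> /eqP ->.
  transitivity (size [:: y]) => //; apply: perm_size; apply: uniq_perm => //.
    by rewrite filter_uniq ?fset_uniq.
  move=> x; rewrite mem_filter mem_seq1; apply/andP/eqP => [[/= nx xS]|->]; last by [].
  by apply/eqP; apply: contraNT nx => xy; have /implyP := H [` xS]; apply.
set e := [rel x z : S | adjacent (val x) (val z)].
have e_sym : symmetric e.
  move=> x z; rewrite /= /adjacent.
  by rewrite ![row_of (val z) == _]eq_sym ![col_of (val z) == _]eq_sym; do ![case: (_ == _)].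
apply/forallP/forallP => [conn x|H x].
  apply/implyP => xy; apply: contraT => nx.
  (* If [x] fails [next_diag], no edge leaves the set of boxes of content at most that of [x], and
     connectedness puts [y] in this set. *)
  have cl : closed e [pred z : S | content (val z) <= content (val x)].
    apply: (intro_closed (sym_connect_sym e_sym)) => z z' /= zz'; rewrite !inE => zx.
    rewrite leNgt; apply/negP => xz'.
    have lt_zz' := le_lt_trans zx xz'.
    have [nz cz'] := adjacent_next_diag (valP z') zz' lt_zz'.
    have zE : val z = val x.
      by apply: (inj_ct (valP z) (valP x)); apply/eqP; rewrite eq_le zx -ltzD1 -cz' xz'.
    by rewrite zE (negPf nx) in nz.
  have /forallP/(_ [` yS]) con := conn x.
  have := closed_connect cl con; rewrite !inE lexx /= => /esym yx.
  case/eqP: xy; apply: (inj_ct (valP x) yS).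
  by apply/eqP; rewrite eq_le yx max_y ?(valP x).
have con_y (z : S) : connect e z [` yS].
  have [p] : exists p : nat, content y = content (val z) + p%:Z.
    exists `|content y - content (val z)|%N.
    by rewrite gez0_abs ?subr_ge0 ?max_y ?(valP z) // [RHS]addrC subrK.
  elim: p z => [|p IHp] z yz.
    have -> : z = [` yS] by apply: val_inj; apply: (inj_ct (valP z) yS); rewrite yz addr0.
    exact: connect0.
  have zy : val z != y by apply/eqP => zy; move: yz; rewrite zy; lia.
  have /implyP/(_ zy)/next_diagP[z' [z'S adj cz']] := H z.
  apply: (connect_trans (y := [` z'S])); first exact: connect1.
  by apply: IHp; rewrite /= cz' yz; lia.
apply/forallP => z; apply: (connect_trans (con_y x)).
by rewrite (sym_connect_sym e_sym) con_y.
Qed.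

End Distinct.

Lemma skew_hook_count : S != fset0 ->
  skew_hook S = ~~ has (upleft S) S && ((count inner S).+1 == count (initial S) S).
Proof.
move=> S0; rewrite /skew_hook.
have -> : [forall b : S, forall b' : S,
    (content (val b) == content (val b')) ==> (b == b')] = ~~ has (upleft S) S.
  apply/forallP/upleftP => [H x y xS yS /eqP cc | inj b].
    by have /forallP/(_ [` yS])/implyP/(_ cc)/eqP[] := H [` xS].
  apply/forallP => b'; apply/implyP => /eqP /inj cc; apply/eqP/val_inj.
  by apply: cc; apply: valP.
rewrite andbC; case: upleftP => //= inj_ct.
exact: connected_count.
Qed.

(** By convexity each occupied row has exactly one box without a left neighbour. *)
Lemma height_count : height S = (count (predC (left S)) S).-1.
Proof.
rewrite /height; congr _.-1.
rewrite -size_filter -(size_map row_of); apply: perm_size.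
apply: uniq_perm; rewrite ?fset_uniq //.
  rewrite map_inj_in_uniq ?filter_uniq ?fset_uniq //.
  have W a b c : (a, b) \in S -> (a, c) \in S -> ~~ left S (a, c) -> (c <= b)%N.
    move=> abS acS; rewrite leqNgt; apply: contra => bc.
    have c0 : (0 < c)%N by apply: leq_ltn_trans bc.
    by rewrite /left c0 /=; apply: (convS abS acS);
      rewrite ?leqnn ?leq_pred // -ltnS prednK ?bc.
  move=> [a b] [c d]; rewrite !mem_filter /row_of /= => /andP[nl1 abS] /andP[nl2 cdS] ac.
  rewrite -{}ac in nl2 cdS *; congr (_, _); apply/eqP.
  by rewrite eqn_leq (W _ _ _ abS cdS) // (W _ _ _ cdS abS).
move=> r; apply/imfsetP/mapP => [[[i j] /= ijS ->]|[x]]; last first.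
  by rewrite mem_filter => /andP[_ xS] ->; exists x.
elim: j ijS => [|j IHj] ijS; first by exists (i, 0%N); rewrite // mem_filter.
case: (boolP (left S (i, j.+1))) => [/= /IHj //|nl].
by exists (i, j.+1); rewrite // mem_filter /= nl.
Qed.

End Counting.

Section GreeneIdentity.
Variable F : numFieldType.
Local Notation ct b := ((content b)%:~R : F).
Local Notation box_poly := (box_poly F).
Local Notation box_wt := (@box_wt F).

Section Shape.
Variable S : diagram.
Hypotheses (convS : convex S).

Let N : {poly F} := \prod_(x <- S) box_poly S x.
Let s : seq F := [seq ct b | b <- S & initial S b].

Lemma initial_contents_uniq : uniq s.
Proof.
rewrite map_inj_in_uniq ?filter_uniq ?fset_uniq // => x y.
rewrite !mem_filter => /andP[ix xS] /andP[iy yS] /intr_inj.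
exact: (initial_content_inj convS).
Qed.

Lemma prod_box_wt u :
  \prod_(x <- S) box_wt S u x = N.[u] / \prod_(c <- s) (u - c).
Proof.
rewrite big_split /= -big_mkcond /= -horner_prod big_map big_filter.
by rewrite prodfV.
Qed.

Lemma initial_box_poly b : b \in S -> initial S b -> box_poly S b = -1.
Proof.
move=> bS /andP[_ /negPf lb]; rewrite /box_poly lb.
by case: ifP => // /(upleft_left convS bS); rewrite lb.
Qed.

(** By [box_wt_del] the factors other than that of [b] may be taken in [S]. The numerator of [b] is
    -1, whence the sign in front of the residue. *)
Lemma prod_box_wt_del b : b \in S -> initial S b ->
  \prod_(x <- S `\ b) box_wt (S `\ b) (ct b) x = - residue N s (ct b).
Proof.
move=> bS ib; have us := initial_contents_uniq.
have -> : \prod_(x <- S `\ b) box_wt (S `\ b) (ct b) x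
    = \prod_(x <- S | x != b) box_wt S (ct b) x.
  rewrite -[RHS]big_filter.
  rewrite (perm_big [seq x <- S | x != b]) /=.
    rewrite big_seq [RHS]big_seq; apply: eq_bigr => x.
    by rewrite mem_filter => /andP[xb xS]; apply: box_wt_del.
  apply: uniq_perm; rewrite ?filter_uniq ?fset_uniq // => x.
  by rewrite mem_filter !inE.
rewrite big_split /= -mulNr /residue /N horner_prod (bigD1_seq b) ?fset_uniq //=.
rewrite initial_box_poly // hornerN hornerC mulN1r opprK; congr (_ * _).
rewrite rem_filter // big_filter big_map big_filter_cond -big_mkcondr prodfV.
congr (_^-1); rewrite big_seq_cond [RHS]big_seq_cond; apply: eq_bigl => x.
case: (boolP (x \in S)) => //= xS; rewrite andbC.
case: (boolP (initial S x)) => //= ix; rewrite content_inj_eq; congr (~~ _).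
by apply/eqP/eqP => [->|/(initial_content_inj convS xS bS ix ib)].
Qed.

Lemma box_polyE x : ~~ upleft S x ->
  box_poly S x = (if inner S x then 'X - (ct x)%:P else 1)
                 * (if predC (left S) x then -1 else 1).
Proof.
move=> /negPf ul; rewrite /box_poly ul /inner /=.
by case: (left S x); case: (up S x); rewrite ?mulr1 ?mul1r.
Qed.

Lemma numerE : ~~ has (upleft S) S ->
  N = (-1) ^+ count (predC (left S)) S *: \prod_(x <- S | inner S x) ('X - (ct x)%:P).
Proof.
move=> /hasPn noul; rewrite /N big_seq.
rewrite (eq_bigr _ (fun x xS => box_polyE (noul x xS))) -big_seq big_split /=.
rewrite -!big_mkcond /= big_const_seq iter_mulr_1 mulrC.
by rewrite -mul_polyC rmorphXn rmorphN1.
Qed.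

Lemma numer0 : has (upleft S) S -> N = 0.
Proof.
case/hasP=> x xS ul; apply/eqP; rewrite prodf_seq_eq0.
by apply/hasP; exists x; rewrite //= /box_poly ul.
Qed.

Lemma size_inner_prod :
  size (\prod_(x <- S | inner S x) ('X - (ct x)%:P)) = (count (inner S) S).+1.
Proof. by rewrite -big_filter size_prod_XsubC size_filter. Qed.

Lemma size_initial_contents : size s = count (initial S) S.
Proof. by rewrite size_map size_filter. Qed.

Lemma size_numer : S != fset0 -> (size N <= size s)%N.
Proof.
move=> S0; case: (boolP (has (upleft S) S)) => [/numer0 ->|noul].
  by rewrite size_poly0.
rewrite numerE //; apply: leq_trans (size_scale_leq _ _) _.
rewrite size_inner_prod size_initial_contents.
by apply: count_inner_lt => //; apply/upleftP.
Qed.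

(** Partial fractions in [u]: the sign from [prod_box_wt_del] turns [(u - ct b)^-1] into
    [(ct b - u)^-1], the first step of a walk from [u] to [b]. *)
Lemma box_wt_recursion u : S != fset0 -> u \notin s ->
  \prod_(x <- S) box_wt S u x
  = \sum_(b <- S | initial S b)
      (ct b - u)^-1 * \prod_(x <- S `\ b) box_wt (S `\ b) (ct b) x.
Proof.
move=> S0 us; rewrite prod_box_wt partial_fractions ?initial_contents_uniq ?size_numer //.
rewrite big_map big_filter big_seq_cond [RHS]big_seq_cond.
apply: eq_bigr => b /andP[bS ib].
by rewrite prod_box_wt_del // mulrN -mulNr -invrN opprB mulrC.
Qed.

(** The sum is minus the coefficient of [N] in degree one less than the number of poles. When
    contents are distinct, [N] has as degree the number of inner boxes, so this is nonzero exactly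
    for connected [S]; the leading sign counts the rows. *)
Lemma sum_box_wt_del : S != fset0 ->
  \sum_(b <- S | initial S b) \prod_(x <- S `\ b) box_wt (S `\ b) (ct b) x
  = if skew_hook S then (-1) ^+ height S else 0.
Proof.
move=> S0; rewrite big_seq_cond.
rewrite (eq_bigr (fun b => - residue N s (ct b))) => [|b /andP[bS ib]]; last first.
  exact: prod_box_wt_del.
rewrite -big_seq_cond sumrN -[\sum_(_ <- S | _) _]big_filter.
rewrite -(big_map (fun b => ct b) xpredT (residue N s)).
rewrite (sum_residue initial_contents_uniq (size_numer S0)).
rewrite skew_hook_count //; case: (boolP (has (upleft S) S)) => [/numer0 ->|noul] /=.
  by rewrite coef0 oppr0.
have inj_ct : {in S &, injective content} by apply/upleftP.
have lt_in := count_inner_lt inj_ct S0.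
rewrite numerE // coefZ size_initial_contents height_count //.
(* Initial boxes have no left neighbour, so the predecessor in the height is not truncated. *)
have [pos_l] : (0 < count (predC (left S)) S)%N.
  rewrite lt0n; apply: contraTneq (leq_ltn_trans (leq0n _) lt_in) => c0.
  rewrite -leqNgt -c0; apply: sub_count => x /andP[]; by [].
rewrite -[in LHS](prednK pos_l) exprS mulN1r.
case: eqP => [ctE|/eqP ctN].
  have /monicP := monic_prod_XsubC [seq x <- S | inner S x] xpredT (fun x => ct x).
  rewrite big_filter /lead_coef size_inner_prod -ctE /= => ->.
  by rewrite mulr1 opprK.
rewrite nth_default ?mulr0 ?oppr0 // size_inner_prod.
have lt2 : ((count (inner S) S).+1 < count (initial S) S)%N.
  by rewrite ltn_neqAle ctN.
by rewrite -ltnS (ltn_predK lt2).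
Qed.

End Shape.

Lemma skew_convex (D la : diagram) : young la -> young D -> convex (la `\` D).
Proof.
move=> yla yD a b x y i j; rewrite !inE => /andP[abD abla] /andP[xyD xyla].
move=> /andP[ai ix] /andP[bj jy]; rewrite (young_le yla xyla) // andbT.
by apply: contra abD => ijD; apply: (young_le yD ijD).
Qed.

Section Skew.
Variable la : diagram.
Hypothesis yla : young la.

(** Since [la] is a Young diagram, the upper and left neighbours of [b] are in [la]; [b] is addable
    when neither is missing from [D]. *)
Lemma addable_initial D b : young D -> D `<=` la -> b \in la ->
  addable D b = (b \in la `\` D) && initial (la `\` D) b.
Proof.
case: b => i j yD /fsubsetP Dla bla; rewrite /addable in_fsetD bla andbT.
case: (boolP ((i, j) \in D)) => //= bD; apply/idP/idP => [yb|].
  have [iin jin] := youngP _ yb i j (fset1U1 _ _).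
  rewrite /initial /up /left /=; apply/andP; split; apply/negP => /andP[pos].
    move: iin; rewrite !inE xpair_eqE eqxx andbT => /orP[/eqP|->] //; lia.
  by move: jin; rewrite !inE xpair_eqE eqxx /= => /orP[/eqP|->] //; lia.
rewrite /initial /up /left /= => /andP[ui lj].
have [ila jla] := youngP _ yla i j bla.
apply/youngP => r c; rewrite !inE => /orP[/eqP[-> ->]|rcD]; last first.
  by have [-> ->] := youngP _ yD r c rcD; rewrite !orbT.
split.
  case: i ui ila {bla bD lj jla} => [|i] /=; first by rewrite eqxx.
  by rewrite !inE => ui ila; move: ui; rewrite ila andbT negbK => ->; rewrite orbT.
case: j lj jla {bla bD ui ila} => [|j] /=; first by rewrite eqxx.
by rewrite !inE => lj jla; move: lj; rewrite jla andbT negbK => ->; rewrite orbT.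
Qed.

Lemma fsetD_fset1U (D : diagram) b : la `\` (b |` D) = (la `\` D) `\ b.
Proof. by apply/fsetP => x; rewrite !inE negb_or -andbA. Qed.

Lemma big_addable (D : diagram) (V : nmodType) (f : box -> V) :
  young D -> D `<=` la ->
  \sum_(b <- enum_fset la | addable D b) f b
  = \sum_(b <- la `\` D | initial (la `\` D) b) f b.
Proof.
move=> yD Dla; rewrite -big_filter -[RHS]big_filter; apply: perm_big.
apply: uniq_perm; rewrite ?filter_uniq ?fset_uniq // => b.
rewrite !mem_filter -[b \in enum_fset la]/(b \in la).
rewrite -[b \in enum_fset _]/(b \in la `\` D).
case: (boolP (b \in la)) => bla; first by rewrite andbT addable_initial // andbC.
by rewrite in_fsetD (negPf bla) !andbF.
Qed.

Lemma addable_sub D b : D `<=` la -> b \in la -> b |` D `<=` la.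
Proof. by move=> Dla bla; rewrite fsubUset fsub1set bla. Qed.

(** Induction on the first box [b]: the rest of the walk starts at [ct b], which is again no pole by
    [initial_del_content]. *)
Lemma sum_walk_wt m D u : young D -> D `<=` la -> #|` la `\` D| = m ->
    u \notin [seq ct b | b <- la `\` D & initial (la `\` D) b] ->
  \sum_(bs <- growths la la D m) walk_wt u (map (fun b => ct b) bs)
  = \prod_(x <- la `\` D) box_wt (la `\` D) u x.
Proof.
elim: m D u => [|m IHm] D u yD Dla szD u_s.
  have /eqP S0 := cardfs0_eq szD.
  have -> : D = la by apply/eqP; rewrite eqEfsubset Dla -fsetD_eq0.
  by rewrite /= eqxx big_seq1 fsetDv big_seq_fset0.
have S0 : la `\` D != fset0 by rewrite -cardfs_gt0 szD.
rewrite big_growthsS box_wt_recursion //; last exact: skew_convex.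
rewrite -big_addable // big_seq_cond [RHS]big_seq_cond.
apply: eq_bigr => b /andP[bla ab]; rewrite /= -mulr_sumr; congr (_ * _).
have yb : young (b |` D) by case/andP: ab.
have := ab; rewrite addable_initial // => /andP[bS ib].
rewrite IHm ?fsetD_fset1U //; first exact: addable_sub.
  by apply/eqP; rewrite -eqSS -szD (cardfsD1 b (la `\` D)) bS.
apply/mapP => -[x]; rewrite mem_filter => /andP[ix xS] /eqP.
rewrite content_inj_eq eq_sym.
by rewrite (negPf (initial_del_content (skew_convex yla yD) bS ib xS ix)).
Qed.

Definition hook_sign (S : diagram) : F := if skew_hook S then (-1) ^+ height S else 0.

(** The walk starts at its own first box, so the factor [(ct b - u)^-1] is absent and the sum of
    residues appears. The default 0 is never reached, as there are [p.+1] boxes. *)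
Lemma sum_walk_wt_hook p D : young D -> D `<=` la -> #|` la `\` D| = p.+1 ->
  \sum_(bs <- growths la la D p.+1)
     (if map (fun b => ct b) bs is c :: cs then walk_wt c cs else 0)
  = hook_sign (la `\` D).
Proof.
move=> yD Dla szD; rewrite big_growthsS /=.
rewrite /hook_sign -sum_box_wt_del //; last 2 first.
- exact: skew_convex.
- by rewrite -cardfs_gt0 szD.
rewrite -big_addable // big_seq_cond [RHS]big_seq_cond.
apply: eq_bigr => b /andP[bla ab].
have yb : young (b |` D) by case/andP: ab.
have := ab; rewrite addable_initial // => /andP[bS ib].
rewrite sum_walk_wt ?fsetD_fset1U //; first exact: addable_sub.
  by apply/eqP; rewrite -eqSS -szD (cardfsD1 b (la `\` D)) bS.
apply/mapP => -[x]; rewrite mem_filter => /andP[ix xS] /eqP.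
rewrite content_inj_eq eq_sym.
by rewrite (negPf (initial_del_content (skew_convex yla yD) bS ib xS ix)).
Qed.

End Skew.
End GreeneIdentity.

(** * Chains of skew hooks *)

Lemma growths_sub U E D m bs :
  bs \in growths U E D m -> (D `<=` E) && (#|` E `\` D| == m).
Proof.
rewrite mem_growths => /and4P[/eqP <- _ gbs /eqP <-].
have /andP[ubs /allP bsD] := growth_uniq gbs.
apply/andP; split; first by apply/fsubsetP => x xD; rewrite in_grow xD orbT.
apply/eqP/perm_size; apply: uniq_perm; rewrite ?fset_uniq // => x.
rewrite -[x \in enum_fset _]/(x \in grow D bs `\` D) in_fsetD in_grow.
by case: (boolP (x \in D)) => xD; rewrite ?orbF //=; apply/esym/negP => /bsD; rewrite xD.
Qed.

Section Chains.
Variable F : numFieldType.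
Local Notation ct b := ((content b)%:~R : F).

Lemma chain_wt_block p m c (cs cs' : seq F) : size cs = p ->
  chain_wt (rcons (nseq p true) false ++ m) ((c :: cs) ++ cs')
  = walk_wt c cs * chain_wt m cs'.
Proof.
elim: p c cs => [|p IHp] c [|c1 cs] //= sz.
  by case: cs' => [|c' cs'] /=; rewrite ?mul1r //; case: m.
by case: sz => /IHp /= ->; rewrite mulrA.
Qed.

Fixpoint hook_sum (la D : diagram) (rho : seq nat) : F :=
  if rho is p :: rho' then
    \sum_(E : fpowerset la
          | [&& young (val E), D `<=` val E & #|` val E `\` D| == p])
      hook_sign F (val E `\` D) * hook_sum la (val E) rho'
  else (D == la)%:R.

(** The growth is cut after the first part; the break in the mask makes the weights multiply, and
    Greene's identity evaluates the first block. *)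
Lemma sum_chain_wt la D rho : young D -> D `<=` la -> 0%N \notin rho ->
  \sum_(bs <- growths la la D (sumn rho))
    chain_wt (block_mask rho) (map (fun b => ct b) bs)
  = hook_sum la D rho.
Proof.
elim: rho D => [|p rho IHrho] D yD Dla.
  by move=> _ /=; case: eqP => _; rewrite ?big_seq1 ?big_nil.
rewrite inE negb_or eq_sym -lt0n => /andP[p0 rho0] /=.
pose w1 (bs : seq box) : F :=
  if map (fun b => ct b) bs is c :: cs then walk_wt c cs else 0.
pose w2 (bs : seq box) : F := chain_wt (block_mask rho) (map (fun b => ct b) bs).
rewrite big_seq (eq_bigr (fun bs => w1 (take p bs) * w2 (drop p bs))); last first.
  move=> bs; rewrite mem_growths => /andP[/eqP sz _].
  have szt : size (take p bs) = p by rewrite size_takel // sz leq_addr.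
  rewrite -{1}(cat_take_drop p bs) map_cat /w1 /block_mask /=.
  case: (take p bs) szt => [|b bs1] /=; first by move=> e; rewrite -e in p0.
  by move=> <- /=; rewrite chain_wt_block ?size_map.
rewrite -big_seq (big_growths_cat (fun bs1 bs2 => w1 bs1 * w2 bs2)) //.
(* An intermediate diagram of the wrong size, or not containing [D], is reached by no growth. *)
rewrite (bigID (fun E : fpowerset la => (D `<=` val E) && (#|` val E `\` D| == p))) /=.
rewrite [X in _ + X]big1 ?addr0 => [|E /andP[_ nE]]; last first.
  by rewrite big_seq big1 // => bs /growths_sub; rewrite (negPf nE).
apply: eq_bigr => E /and3P[yE DE /eqP szE].
have Ela : val E `<=` la by rewrite -fpowersetE; apply: valP.
under eq_bigr do rewrite -mulr_sumr.
rewrite -mulr_suml IHrho //; congr (_ * _).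
(* Greene's identity for [E] draws its boxes from [E] instead of [la]. *)
rewrite -(perm_big _ (growths_univ D p Ela)) /=.
by case: (p) p0 szE => // p' _ szE; apply: sum_walk_wt_hook.
Qed.

(** * Hook sequences by induction on their first step *)

Section HookSequences.
Variable la : diagram.

Definition cons_seq r (E : fpowerset la) (S : {ffun 'I_r -> fpowerset la}) :
    {ffun 'I_r.+1 -> fpowerset la} :=
  [ffun i => if unlift ord0 i is Some j then S j else E].

Lemma cons_seq0 r E (S : {ffun 'I_r -> fpowerset la}) : cons_seq E S ord0 = E.
Proof. by rewrite ffunE unlift_none. Qed.

Lemma cons_seqS r E (S : {ffun 'I_r -> fpowerset la}) i :
  cons_seq E S (lift ord0 i) = S i.
Proof. by rewrite ffunE liftK. Qed.

Lemma widen_lift0 r (i : 'I_r) :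
  widen_ord (leqnSn r.+1) (lift ord0 i) = lift ord0 (widen_ord (leqnSn r) i).
Proof. exact: val_inj. Qed.

Lemma widen_ord0 r : widen_ord (leqnSn r.+1) ord0 = ord0.
Proof. exact: val_inj. Qed.

Lemma hook_seq_cons p rho (E : fpowerset la)
    (S : {ffun 'I_(size rho).+1 -> fpowerset la}) : young (val E) ->
  hook_seq (rho := p :: rho) (val E) (cons_seq E S)
  = [&& val E `<=` val (S ord0), skew_hook (val (S ord0) `\` val E),
        #|` val (S ord0) `\` val E| == p & hook_seq (val (S ord0)) S].
Proof.
move=> yE; rewrite /hook_seq cons_seq0 eqxx /=.
have -> : ord_max = lift ord0 ord_max :> 'I_(size rho).+2 by apply: val_inj.
rewrite cons_seqS eqxx /=.
have -> : [forall i, young (val (cons_seq E S i))] = [forall i, young (val (S i))].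
  apply/forallP/forallP => yS i; first by rewrite -(cons_seqS E S).
  by case: (unliftP ord0 i) => [j|] ->; rewrite ?cons_seqS ?cons_seq0.
case: (_ == la) => /=; last by rewrite !andbF.
case: [forall i, _] => /=; last by rewrite !andbF.
apply/forallP/and4P => [H|[H1 H2 H3 /forallP H] i].
  have := H ord0; rewrite widen_ord0 cons_seq0 cons_seqS /= => /and3P[-> -> ->].
  split=> //; apply/forallP => i.
  by have := H (lift ord0 i); rewrite widen_lift0 !cons_seqS.
case: (unliftP ord0 i) => [j|] ->; first by rewrite widen_lift0 !cons_seqS; apply: H.
by rewrite widen_ord0 cons_seq0 cons_seqS H1 H2.
Qed.

Lemma seq_height_cons r (E : fpowerset la) (S : {ffun 'I_r.+1 -> fpowerset la}) :
  seq_height (cons_seq E S) = (height (val (S ord0) `\` val E) + seq_height S)%N.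
Proof.
rewrite /seq_height big_ord_recl widen_ord0 cons_seq0 cons_seqS; congr (_ + _)%N.
by apply: eq_bigr => i _; rewrite widen_lift0 !cons_seqS.
Qed.

Lemma sum_hook_seq (D : diagram) rho : young D -> D `<=` la ->
  \sum_(S : {ffun 'I_(size rho).+1 -> fpowerset la} | hook_seq D S)
    (-1) ^+ seq_height S = hook_sum la D rho.
Proof.
elim: rho D => [|p rho IHrho] D yD Dla.
  have D_in : D \in fpowerset la by rewrite fpowersetE.
  pose S0 : {ffun 'I_1 -> fpowerset la} := [ffun=> [` D_in]].
  rewrite /= (eq_bigl (fun S => (D == la) && (S == S0))) => [|S].
    case: (D == la) => /=; last by rewrite big_pred0.
    by rewrite big_pred1_eq /seq_height big_ord0 expr0.
  rewrite /hook_seq; have -> : ord_max = ord0 :> 'I_1 by apply: val_inj.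
  apply/idP/idP => [/and4P[/eqP e0 e1 _ _]|/andP[Dl /eqP ->]].
    rewrite -{1}e0 e1; apply/eqP/ffunP => i; rewrite ffunE ord1.
    by apply: val_inj; rewrite /= -e0.
  rewrite !ffunE /= eqxx Dl /=; apply/andP; split; apply/forallP => i.
    by rewrite ffunE.
  by case: i.
have D_in : D \in fpowerset la by rewrite fpowersetE.
(* The first term of a hook sequence is forced to be [D], so the sequence is determined by its
   tail. *)
pose x0 : fpowerset la := [` D_in].
pose behead (S : {ffun 'I_(size rho).+2 -> fpowerset la}) :
  {ffun 'I_(size rho).+1 -> fpowerset la} := [ffun i => S (lift ord0 i)].
rewrite (reindex_onto (cons_seq x0) behead) => [|S hS]; last first.
  apply/ffunP => i; rewrite ffunE; case: (unliftP ord0 i) => [j|] ->.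
    by rewrite ffunE.
  by apply: val_inj; case/andP: hS => /eqP ->.
pose step (E : diagram) := [&& D `<=` E, skew_hook (E `\` D) & #|` E `\` D| == p].
rewrite (eq_bigl (fun S : {ffun 'I_(size rho).+1 -> fpowerset la} =>
  step (val (S ord0)) && hook_seq (val (S ord0)) S)); last first.
  move=> S; rewrite (_ : behead _ = S); last first.
    by apply/ffunP => i; rewrite ffunE cons_seqS.
  by rewrite eqxx andbT -[D]/(val x0) hook_seq_cons // /step -!andbA.
rewrite (partition_big (fun S : {ffun 'I_(size rho).+1 -> fpowerset la} => S ord0)
          (fun E => step (val E) && young (val E))) /=; last first.
  by move=> S /andP[-> /and4P[_ _ /forallP yS _]]; apply: yS.
rewrite [RHS](bigID (fun E : fpowerset la => skew_hook (val E `\` D))) /=.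
rewrite [X in _ = _ + X]big1 ?addr0 => [|E /andP[_ /negPf nE]]; last first.
  by rewrite /hook_sign nE mul0r.
apply: eq_big => [E|E /andP[/and3P[DE hE szE] yE]].
  by rewrite /step; case: (young _); case: (_ `<=` _); case: (skew_hook _); case: (_ == p).
rewrite /hook_sign hE -IHrho //; last by rewrite -fpowersetE; apply: valP.
rewrite mulr_sumr; apply: eq_big => [S|S /andP[_ /eqP SE]].
  case: (altP (S ord0 =P E)) => [->|nE]; first by rewrite /step DE hE szE andbT.
  rewrite andbF; apply/esym/negP => /andP[/eqP SE _].
  by case/eqP: nE; apply: val_inj.
by rewrite seq_height_cons SE exprD.
Qed.

End HookSequences.
End Chains.

(** * Restriction to a Young subgroup *)

(** If [b] and [b'] differ, each lies in the smaller diagram obtained by removing the other. The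
    upper left one of the two is then in the diagram from which it was removed. *)
Lemma removable_content_inj (E E' : diagram) b b' :
    young E -> young E' -> addable E b -> addable E' b' ->
  b |` E = b' |` E' -> content b = content b' -> b = b' /\ E = E'.
Proof.
move=> yE yE' /andP[bE _] /andP[bE' _] bb' cc.
have {cc} eq_b : b = b'.
  case: b b' bE bE' bb' cc => [i j] [i' j'] bE bE' bb' /eqP.
  rewrite content_eq /= => /eqP cc; apply/eqP; apply: contraT => neq.
  have /(_ (fset1U1 _ _)) : (i', j') \in (i', j') |` E' -> (i', j') \in E.
    by rewrite -bb' !inE eq_sym (negPf neq).
  have /(_ (fset1U1 _ _)) : (i, j) \in (i, j) |` E -> (i, j) \in E'.
    by rewrite bb' !inE (negPf neq).
  case: (leqP i i') => [ii'|/ltnW i'i] b_in b_in'.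
    by case/negP: bE; apply: (young_le yE b_in' ii'); lia.
  by case/negP: bE'; apply: (young_le yE' b_in i'i); lia.
split=> //; rewrite -eq_b in bE' bb'; apply/fsetP => x.
have /fsetP/(_ x) := bb'; rewrite !inE.
by case: (eqVneq x b) => [->|] //=; rewrite (negPf bE) (negPf bE').
Qed.

(** Growths are read backwards: the last content determines the box to remove. *)
Lemma growth_content_last_inj D D' bs bs' : young D -> young D' ->
    is_growth D bs -> is_growth D' bs' -> grow D bs = grow D' bs' ->
  map content bs = map content bs' -> D = D'.
Proof.
move=> yD yD'; elim/last_ind: bs bs' => [|bs b IHbs] bs'.
  by case/lastP: bs' => [|bs' b'] _ _ //= _ /(congr1 size); rewrite size_map size_rcons.
case/lastP: bs' => [|bs' b'] gbs gbs' gE cE.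
  by have := congr1 size cE; rewrite !size_map size_rcons.
move: cE; rewrite !map_rcons => /rcons_inj[cE cb].
move: gbs gbs' gE; rewrite -!cats1 !is_growth_cat !grow_cat /=.
move=> /and3P[gbs ab _] /and3P[gbs' ab' _] gE.
have [_ EE'] := removable_content_inj (young_grow yD gbs) (young_grow yD' gbs') ab ab' gE cb.
exact: IHbs gbs gbs' EE' cE.
Qed.

Section Embedding.
Variables l k : nat.

Lemma emb_firstM s t : emb_first k (s * t) = (@emb_first l k s * emb_first k t)%g.
Proof.
apply/permP=> i; rewrite -(splitK i).
by case: (split i) => a /=; rewrite permM ?emb_firstL ?emb_firstR ?permM.
Qed.

Lemma emb_first1 : @emb_first l k 1 = 1%g.
Proof.
apply/permP=> i; rewrite -(splitK i).
by case: (split i) => a /=; rewrite ?emb_firstL ?emb_firstR !perm1.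
Qed.

Lemma emb_first_tperm x y :
  @emb_first l k (tperm x y) = tperm (lshift k x) (lshift k y).
Proof.
apply/permP=> i; rewrite -(splitK i); case: (split i) => a /=.
  rewrite emb_firstL; case: tpermP => [->|->|/eqP ax /eqP ay];
    rewrite ?tpermL ?tpermR // tpermD // eq_sym (inj_eq (@lshift_inj _ _)) //.
by rewrite emb_firstR tpermD // eq_lrshift.
Qed.

Lemma emb_last_tperm x y :
  @emb_last l k (tperm x y) = tperm (rshift l x) (rshift l y).
Proof.
apply/permP=> i; rewrite -(splitK i); case: (split i) => a /=.
  by rewrite emb_lastL tpermD // eq_rlshift.
rewrite emb_lastR; case: tpermP => [->|->|/eqP ax /eqP ay];
  rewrite ?tpermL ?tpermR // tpermD // eq_sym (inj_eq (@rshift_inj _ _)) //.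
Qed.

Lemma emb_first_chain_prod m s :
  @emb_first l k (chain_prod m s) = chain_prod m (map (lshift k) s).
Proof.
elim: s m => [|x [|y s] IHs] [|b m] //=; rewrite ?emb_first1 //.
have /= <- := IHs m; rewrite emb_firstM; congr (_ * _)%g.
by case: b; rewrite ?emb_first_tperm ?emb_first1.
Qed.

Lemma emb_last_chain_prod m s :
  @emb_last l k (chain_prod m s) = chain_prod m (map (@rshift l k) s).
Proof.
elim: s m => [|x [|y s] IHs] [|b m] //=; rewrite ?emb_last1 //.
have /= <- := IHs m; rewrite emb_lastM; congr (_ * _)%g.
by case: b; rewrite ?emb_last_tperm ?emb_last1.
Qed.

Lemma enum_ord_add :
  enum 'I_(l + k) = map (lshift k) (enum 'I_l) ++ map (@rshift l k) (enum 'I_k).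
Proof.
apply: (inj_map val_inj); rewrite val_enum_ord map_cat iotaD.
have -> : map val (map (lshift k) (enum 'I_l)) = iota 0 l.
  by rewrite -val_enum_ord -[LHS]map_comp; apply: eq_map.
have -> : map val (map (@rshift l k) (enum 'I_k)) = map (addn l) (iota 0 k).
  by rewrite -val_enum_ord -[LHS]map_comp -[RHS]map_comp; apply: eq_map.
by rewrite -iotaDl addn0.
Qed.

Lemma emb_conj g s t u :
  (@emb_first l k (g ^ t) * emb_last l (s ^ u)
   = (emb_first k g * emb_last l s) ^ (emb_first k t * emb_last l u))%g.
Proof.
have firstJ : @emb_first l k (g ^ t) = (emb_first k g ^ emb_first k t)%g.
  apply: (mulgI (emb_first k t)); rewrite -emb_firstM /conjg mulKVg.
  by rewrite mulKVg emb_firstM.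
have lastJ : @emb_last l k (s ^ u) = (emb_last l s ^ emb_last l u)%g.
  apply: (mulgI (emb_last l u)); rewrite -emb_lastM /conjg mulKVg.
  by rewrite mulKVg emb_lastM.
have fixed x y : (emb_first k x ^ emb_last l y = @emb_first l k x)%g.
  by rewrite /conjg emb_comm mulKg.
have fixed' x y : (emb_last l y ^ emb_first k x = @emb_last l k y)%g.
  by rewrite /conjg -emb_comm mulKg.
by rewrite conjMg !conjgM fixed' -firstJ -lastJ fixed.
Qed.

End Embedding.

Lemma chain_prod_cat (T : finType) rho m (s s' : seq T) :
  0%N \notin rho -> size s = sumn rho ->
  chain_prod (block_mask rho ++ m) (s ++ s')
  = (chain_prod (block_mask rho) s * chain_prod m s')%g.
Proof.
elim: rho s => [|p rho IHrho] s /=.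
  by move=> _ /size0nil ->; rewrite mul1g.
rewrite inE negb_or => /andP[p0 rho0] sz.
have sz_t : size (take p s) = p.-1.+1.
  by rewrite size_takel ?prednK ?lt0n ?(eq_sym p) // sz leq_addr.
rewrite -(cat_take_drop p s) /block_mask /= -!catA !chain_prod_block_cat //.
by rewrite IHrho ?mulgA // size_drop sz addKn.
Qed.

Lemma chain_wt_cat (F : numFieldType) rho m (s s' : seq F) :
  0%N \notin rho -> size s = sumn rho ->
  chain_wt (block_mask rho ++ m) (s ++ s')
  = chain_wt (block_mask rho) s * chain_wt m s'.
Proof.
elim: rho s => [|p rho IHrho] s /=.
  by move=> _ /size0nil ->; rewrite mul1r.
rewrite inE negb_or => /andP[p0 rho0] sz.
have sz_t : size (take p s) = p.-1.+1.
  by rewrite size_takel ?prednK ?lt0n ?(eq_sym p) // sz leq_addr.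
have IH := IHrho (drop p s) rho0.
rewrite -(cat_take_drop p s) /block_mask /= -!catA.
case: (take p s) sz_t => [|c cs] // [szc].
by rewrite !chain_wt_block // IH ?mulrA // size_drop sz addKn.
Qed.

(** * Projectors onto spans of basis vectors *)

Section Projector.
Variables (F : fieldType) (I : finType) (d : nat).
Variables (v : I -> 'rV[F]_d) (w : I -> 'cV[F]_d) (pi : pred I).
Hypothesis vw : forall T T', v T *m w T' = (T == T')%:R%:M.
Hypothesis wv : \sum_T w T *m v T = 1%:M.

Definition projector : 'M[F]_d := \sum_(T | pi T) w T *m v T.

Lemma mul_projector T : v T *m projector = (pi T)%:R *: v T.
Proof.
rewrite mulmx_sumr big_mkcond (bigD1 T) //= big1 ?addr0 => [|U UT].
  by case: ifP => _; rewrite ?scale0r // mulmxA vw eqxx mul1mx scale1r.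
by rewrite mulmxA vw eq_sym (negPf UT) raddf0 mul0mx if_same.
Qed.

Lemma entry_inj (K L : 'M[F]_d) : entry v w K =2 entry v w L -> K = L.
Proof.
move=> KL; rewrite -[K]mul1mx -[L]mul1mx -wv !mulmx_suml; apply: eq_bigr => T _.
rewrite -!mulmxA; congr (_ *m _).
rewrite -[v T *m K]mulmx1 -[v T *m L]mulmx1 -wv !mulmx_sumr.
by apply: eq_bigr => U _; rewrite !mulmxA !entryE KL.
Qed.

Lemma projector_comm (K : 'M[F]_d) :
  (forall T T', entry v w K T T' != 0 -> pi T = pi T') ->
  projector *m K = K *m projector.
Proof.
move=> piK; apply: entry_inj => T T'.
rewrite (entry_eigenl _ mul_projector) (entry_eigenr vw wv mul_projector).
have [->|/piK ->] := eqVneq (entry v w K T T') 0; first by rewrite mulr0 mul0r.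
by rewrite mulrC.
Qed.

Lemma mxtrace_projector (K : 'M[F]_d) :
  \tr (projector *m K) = \sum_(T | pi T) entry v w K T T.
Proof.
rewrite (mxtrace_entry wv) [RHS]big_mkcond; apply: eq_bigr => T _.
by rewrite (entry_eigenl _ mul_projector); case: (pi T); rewrite ?mul1r ?mul0r.
Qed.

End Projector.

Lemma sorted_enum_ord n :
  sorted (fun x y : 'I_n => val y == (val x).+1) (enum 'I_n).
Proof.
have : sorted (fun x y : nat => y == x.+1) (map val (enum 'I_n)).
  rewrite val_enum_ord; elim: n 0%N => [|[|n] IHn] m //=.
  by rewrite eqxx; apply: IHn.
by rewrite sorted_map.
Qed.

Section ShapeBasis.
Variables (F : numFieldType) (n : nat) (la : diagram) (d : nat).
Variable rG : mx_representation F [set: 'S_n] d.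
Hypotheses (yla : young la) (sz_la : #|` la| = n).
Variables (v : syt n la -> 'rV[F]_d) (w : syt n la -> 'cV[F]_d).
Hypothesis vw : forall T T', v T *m w T' = (T == T')%:R%:M.
Hypothesis wv : \sum_T w T *m v T = 1%:M.
Hypothesis vX : forall (T : syt n la) (i : 'I_n),
  v T *m jucys_murphy rG i = (content (val (val T i)))%:~R *: v T.
Local Notation ct b := ((content b)%:~R : F).

Lemma syt_growth (T : syt n la) : is_growth fset0 (boxes (val T)).
Proof. by have /andP[] := boxes_growth yla (valP T). Qed.

Lemma syt_grow (T : syt n la) : grow fset0 (boxes (val T)) = la.
Proof. by have /andP[_ /eqP] := boxes_growth yla (valP T). Qed.

Lemma entry_chain_enum m T :
  entry v w (rG (chain_prod m (enum 'I_n))) T T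
  = chain_wt m (map (fun b => ct b) (boxes (val T))).
Proof.
rewrite -map_comp; case: (enum 'I_n) (sorted_enum_ord n) => [|x s] /= xs.
  by case: m => [|b m]; rewrite repr_mx1 (entry1 vw) eqxx.
exact: (entry_chain_prod vw wv (c := fun T i => ct (val (val T i))) vX).
Qed.

(** Characteristic 0 allows integer contents to be recovered from eigenvalues. *)
Lemma entry_content K T T' i : entry v w K T T' != 0 ->
  K *m jucys_murphy rG i = jucys_murphy rG i *m K ->
  content (val (val T i)) = content (val (val T' i)).
Proof.
move=> nz KX.
have := entry_comm_eigen vw wv (c := fun T => ct (val (val T i))) (fun T => vX T i) (esym KX) nz.
exact: intr_inj.
Qed.

Lemma sum_syt (V : nmodType) (f : seq box -> V) :
  \sum_(T : syt n la) f (boxes (val T)) = \sum_(bs <- growths la la fset0 n) f bs.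
Proof. by rewrite -(perm_big _ (perm_boxes yla sz_la)) /= big_map enumT. Qed.

Lemma mxtrace_chain_enum m :
  \tr (rG (chain_prod m (enum 'I_n)))
  = \sum_(bs <- growths la la fset0 n) chain_wt m (map (fun b => ct b) bs).
Proof.
rewrite (mxtrace_entry wv) -sum_syt; apply: eq_bigr => T _.
exact: entry_chain_enum.
Qed.

(** An intertwiner commutes with all Jucys-Murphy elements, whose joint spectrum is simple. This
    supplies the last hypothesis of [char_norm1]. *)
Lemma syt_eigenline (T : syt n la) (A : 'M[F]_d) :
  intertwines rG rG A -> exists a, v T *m A = a *: v T.
Proof.
move=> HA; exists (entry v w A T T).
rewrite -[v T *m A]mulmx1 -wv mulmx_sumr (bigD1 T) //= big1 ?addr0 => [|U UT].
  by rewrite mulmxA entryE mul_scalar_mx.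
rewrite mulmxA entryE; have [->|nz] := eqVneq (entry v w A T U) 0.
  by rewrite raddf0 mul0mx.
case/eqP: UT; apply/val_inj/boxes_inj.
apply: (growth_content_inj (syt_growth U) (syt_growth T)).
rewrite -!map_comp; apply: eq_map => i /=; apply/esym/(entry_content nz).
rewrite mulmx_suml mulmx_sumr; apply: eq_bigr => j _; exact/esym/HA.
Qed.

End ShapeBasis.

(** * The skew character as a sum over chains *)

Section SkewCharacter.
Variables (F : numFieldType) (l k : nat) (mu la : diagram) (dmu dla : nat).
Variable rmu : mx_representation F [set: 'S_l] dmu.
Variable rla : mx_representation F [set: 'S_(l + k)] dla.
Hypotheses (young_mu : young mu) (young_la : young la) (mu_la : mu `<=` la).
Hypotheses (size_mu : #|` mu| = l) (size_la : #|` la| = (l + k)%N).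
Local Notation ct b := ((content b)%:~R : F).

Lemma res_repr_subproof :
  mx_repr [set: 'S_l] (fun g => rla (emb_first k g)).
Proof.
split=> [|g h _ _]; first by rewrite emb_first1 repr_mx1.
by rewrite emb_firstM repr_mxM ?inE.
Qed.
Definition res_repr := MxRepresentation res_repr_subproof.

Lemma jm_lshift (i : 'I_l) :
  jucys_murphy rla (lshift k i) = \sum_(j < l | (j < i)%N) res_repr (tperm j i).
Proof.
rewrite /jucys_murphy big_split_ord /= [X in _ + X]big1 ?addr0.
  by apply: eq_bigr => j _; rewrite emb_first_tperm.
by move=> j /=; rewrite ltnNge ltnW // ltn_addr.
Qed.

Lemma emb_first_jm_comm (g : 'S_l) (i : 'I_k) :
  rla (emb_first k g) *m jucys_murphy rla (rshift l i)
  = jucys_murphy rla (rshift l i) *m rla (emb_first k g).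
Proof.
apply/esym/jm_commute; first exact: emb_firstR.
move=> j; rewrite -(splitK j); case: (split j) => a /=.
  by rewrite emb_firstL /= !ltn_addr.
by rewrite emb_firstR.
Qed.

Lemma emb_last_jm_comm (s : 'S_k) (i : 'I_l) :
  rla (emb_last l s) *m jucys_murphy rla (lshift k i)
  = jucys_murphy rla (lshift k i) *m rla (emb_last l s).
Proof.
apply/esym/jm_commute; first exact: emb_lastL.
move=> j; rewrite -(splitK j); case: (split j) => a /=.
  by rewrite emb_lastL.
by rewrite emb_lastR /= !ltnNge !(leq_trans (ltnW (ltn_ord i))) ?leq_addr.
Qed.

Lemma take_boxes (T : {ffun 'I_(l + k) -> la}) :
  take l (boxes T) = [seq val (T (lshift k i)) | i <- enum 'I_l].
Proof.
rewrite /boxes enum_ord_add map_cat take_size_cat ?size_map -?enumT ?size_enum_ord //.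
by rewrite -[LHS]map_comp.
Qed.

Lemma drop_boxes (T : {ffun 'I_(l + k) -> la}) :
  drop l (boxes T) = [seq val (T (rshift l i)) | i <- enum 'I_k].
Proof.
rewrite /boxes enum_ord_add map_cat drop_size_cat ?size_map -?enumT ?size_enum_ord //.
by rewrite -[LHS]map_comp.
Qed.

Definition inner_shape (T : syt (l + k) la) : diagram :=
  grow fset0 (take l (boxes (val T))).

Lemma growth_take (T : syt (l + k) la) :
  is_growth fset0 (take l (boxes (val T)))
  && is_growth (inner_shape T) (drop l (boxes (val T))).
Proof. by rewrite -is_growth_cat cat_take_drop syt_growth. Qed.

Variables (v : syt (l + k) la -> 'rV[F]_dla) (w : syt (l + k) la -> 'cV[F]_dla).
Hypothesis vw : forall T T', v T *m w T' = (T == T')%:R%:M.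
Hypothesis wv : \sum_T w T *m v T = 1%:M.
Hypothesis vX : forall (T : syt (l + k) la) (i : 'I_(l + k)),
  v T *m jucys_murphy rla i = (content (val (val T i)))%:~R *: v T.

(** The subgroup ['S_l] commutes with the last [k] Jucys-Murphy elements. It thus preserves the last
    [k] contents, and going back from [la] along these recovers the inner shape. *)
Lemma emb_first_inner_shape (g : 'S_l) T T' :
  entry v w (rla (emb_first k g)) T T' != 0 -> inner_shape T = inner_shape T'.
Proof.
move=> nz; have /andP[g1 g2] := growth_take T; have /andP[g1' g2'] := growth_take T'.
apply: (growth_content_last_inj _ _ g2 g2'); rewrite ?young_grow ?young_fset0 //.
  by rewrite -!grow_cat !cat_take_drop !syt_grow.
rewrite !drop_boxes -!map_comp; apply: eq_map => i /=.
exact: (entry_content vw wv vX nz (emb_first_jm_comm g i)).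
Qed.

(** The subgroup ['S_k] commutes with the first [l] Jucys-Murphy elements, whose eigenvalues
    determine the first [l] boxes. *)
Lemma emb_last_inner_shape (s : 'S_k) T T' :
  entry v w (rla (emb_last l s)) T T' != 0 -> inner_shape T = inner_shape T'.
Proof.
move=> nz; have /andP[g1 _] := growth_take T; have /andP[g1' _] := growth_take T'.
congr (grow _ _); apply: (growth_content_inj g1 g1').
rewrite !take_boxes -!map_comp; apply: eq_map => i /=.
exact: (entry_content vw wv vX nz (emb_last_jm_comm s i)).
Qed.

(** This projects onto the [mu]-isotypic part of the restriction to ['S_l]. *)
Let P := projector v w (fun T => inner_shape T == mu).

Lemma projector_emb_first (g : 'S_l) :
  P *m rla (emb_first k g) = rla (emb_first k g) *m P.
Proof. by apply: projector_comm => // T T' /emb_first_inner_shape ->. Qed.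

Lemma projector_emb_last (s : 'S_k) :
  P *m rla (emb_last l s) = rla (emb_last l s) *m P.
Proof. by apply: projector_comm => // T T' /emb_last_inner_shape ->. Qed.

Variables (v' : syt l mu -> 'rV[F]_dmu) (w' : syt l mu -> 'cV[F]_dmu).
Hypothesis vw' : forall T T', v' T *m w' T' = (T == T')%:R%:M.
Hypothesis wv' : \sum_T w' T *m v' T = 1%:M.
Hypothesis vX' : forall (T : syt l mu) (i : 'I_l),
  v' T *m jucys_murphy rmu i = (content (val (val T i)))%:~R *: v' T.

(** The image of [v' U] has the Jucys-Murphy eigenvalues of [U], so only those [v T] occur in it
    whose first [l] boxes are those of [U]. *)
Lemma intertwines_projector (A : 'M[F]_(dmu, dla)) :
  intertwines rmu res_repr A -> A *m P = A.
Proof.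
move=> HA; rewrite -[A]mul1mx -wv' !mulmx_suml; apply: eq_bigr => U _.
rewrite -!mulmxA; congr (_ *m _); rewrite mulmxA -[v' U *m A]mulmx1 -wv.
rewrite mulmx_sumr mulmx_suml; apply: eq_bigr => T _.
rewrite -!mulmxA (mul_projector _ vw).
case: eqP => [_|nmu]; first by rewrite scale1r.
rewrite scale0r !mulmx0 !mulmxA.
suff -> : v' U *m A *m w T = 0 by rewrite mul0mx.
apply/eqP; apply: contra_notT nmu => nz.
have ctE i : content (val (val T (lshift k i))) = content (val (val U i)).
  have XA : jucys_murphy rmu i *m A = A *m jucys_murphy rla (lshift k i).
    rewrite jm_lshift mulmx_suml mulmx_sumr; apply: eq_bigr => j _; exact: HA.
  have := congr1 (fun K => v' U *m K *m w T) XA; rewrite /= !mulmxA vX'.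
  rewrite -!mulmxA (dual_eigen vw wv (c := fun T => ct (val (val T (lshift k i))))); last first.
    by move=> T1; apply: vX.
  rewrite -!scalemxAl -!scalemxAr !mulmxA => /eqP.
  by rewrite -subr_eq0 -scalerBl scaler_eq0 (negPf nz) orbF subr_eq0 => /eqP/intr_inj.
have /andP[gT _] := growth_take T.
rewrite /inner_shape (growth_content_inj gT (syt_growth young_mu U)) ?syt_grow //.
by rewrite take_boxes -!map_comp; apply: eq_map => i; apply: ctE.
Qed.

Lemma mxtrace_projector_chain rho m : 0%N \notin rho -> sumn rho = l ->
  \sum_(T : syt (l + k) la | inner_shape T == mu)
     chain_wt (block_mask rho ++ m) (map (fun b => ct b) (boxes (val T)))
  = (\sum_(bs <- growths mu mu fset0 l) chain_wt (block_mask rho) (map (fun b => ct b) bs))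
    * \sum_(bs <- growths la la mu k) chain_wt m (map (fun b => ct b) bs).
Proof.
move=> rho0 rhol.
(* The indicator carries the condition on the inner shape into the sum over all growths, where it
   then selects [mu] as the intermediate diagram. *)
pose f1 bs := (grow fset0 bs == mu)%:R * chain_wt (block_mask rho) (map (fun b => ct b) bs).
pose f2 bs := chain_wt m (map (fun b => ct b) bs).
transitivity (\sum_(bs <- growths la la fset0 (l + k)) f1 (take l bs) * f2 (drop l bs)).
  rewrite -(sum_syt young_la size_la (fun bs => f1 (take l bs) * f2 (drop l bs))).
  rewrite big_mkcond; apply: eq_bigr => T _; rewrite /f1 /f2 -/(inner_shape T).
  case: ifP => _; last by rewrite mul0r mul0r.
  rewrite mul1r -{1}(cat_take_drop l (boxes (val T))) map_cat chain_wt_cat //.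
  by rewrite size_map size_takel ?size_boxes ?leq_addr.
rewrite (big_growths_cat (fun b1 b2 => f1 b1 * f2 b2)) ?young_fset0 ?fsub0set //.
have mu_in : mu \in fpowerset la by rewrite fpowersetE.
rewrite (bigD1 [` mu_in]) //= [X in _ + X]big1 ?addr0 => [|E /andP[_ nE]]; last first.
  rewrite big_seq big1 // => b1; rewrite mem_growths => /and4P[_ _ _ /eqP gE].
  rewrite big1 // => b2 _; rewrite /f1 gE; case: eqP => [Emu|_]; last by rewrite !mul0r.
  by case/eqP: nE; apply: val_inj.
under eq_bigr do rewrite -mulr_sumr.
rewrite -mulr_suml (perm_big _ (growths_univ _ _ mu_la)) /=; congr (_ * _).
rewrite big_seq [RHS]big_seq; apply: eq_bigr => bs.
by rewrite mem_growths => /and4P[_ _ _ gE]; rewrite /f1 gE mul1r.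
Qed.

(** Since [P] commutes with both subgroups, both sides depend only on the conjugacy classes of [g]
    and [s]. For the standard representatives the product is one chain over ['I_(l + k)], broken
    after [l], and its diagonal coefficients factor. *)
Lemma mxtrace_projector_emb (g : 'S_l) (s : 'S_k) :
  \tr (P *m rla (emb_first k g * emb_last l s)%g)
  = \tr (rmu g) * hook_sum F la mu (cycle_type s).
Proof.
have [t gE] := conj_chain_prod g; have [u sE] := conj_chain_prod s.
set g0 := chain_prod _ _ in gE; set s0 := chain_prod _ _ in sE.
have -> : \tr (rmu g) = \tr (rmu g0).
  rewrite gE /conjg !repr_mxM ?inE // mxtrace_mulC -mulmxA -repr_mxM ?inE //.
  by rewrite mulgV repr_mx1 mulmx1.
have -> : \tr (P *m rla (emb_first k g * emb_last l s)%g)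
    = \tr (P *m rla (emb_first k g0 * emb_last l s0)%g).
  rewrite gE sE emb_conj; set h := (emb_first k t * emb_last l u)%g.
  have Ph : P *m rla h^-1%g = rla h^-1%g *m P.
    have {}Ph : P *m rla h = rla h *m P.
      by rewrite /h repr_mxM ?inE // mulmxA projector_emb_first -!mulmxA projector_emb_last.
    rewrite -[LHS]mul1mx -(repr_mx1 rla) -(mulVg h) repr_mxM ?inE // -!mulmxA.
    congr (_ *m _); rewrite mulmxA -Ph -mulmxA -repr_mxM ?inE // mulgV repr_mx1.
    by rewrite mulmx1.
  rewrite /conjg repr_mxM ?inE // mulmxA Ph -mulmxA mxtrace_mulC.
  by rewrite repr_mxM ?inE // -!mulmxA -repr_mxM ?inE // mulgV repr_mx1 mulmx1.
rewrite (mxtrace_projector _ vw wv) emb_first_chain_prod emb_last_chain_prod.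
rewrite -chain_prod_cat ?cycle_type_neq0 ?size_map -?enumT ?size_enum_ord ?sumn_cycle_type //.
rewrite -enum_ord_add (eq_bigr _ (fun T _ => entry_chain_enum vw wv vX _ T)).
rewrite mxtrace_projector_chain ?cycle_type_neq0 ?sumn_cycle_type //.
rewrite -(mxtrace_chain_enum young_mu size_mu vw' wv' vX'); congr (_ * _).
by rewrite -sum_chain_wt ?cycle_type_neq0 // sumn_cycle_type.
Qed.

(** After averaging over ['S_l] the sum over chains comes out as a constant, leaving the norm of an
    irreducible character, which is 1. *)
Lemma skew_char_hook_sum (s : 'S_k) : mx_irreducible rmu ->
  skew_char rmu rla s = hook_sum F la mu (cycle_type s).
Proof.
move=> irr_mu.
have cardS : #|'S_l|%:R != 0 :> F.
  by rewrite pnatr_eq0 -lt0n; apply/card_gt0P; exists 1%g.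
rewrite (skew_char_eq s cardS (r2 := res_repr) (P := P)) //; last 2 first.
- exact: projector_emb_first.
- exact: intertwines_projector.
under eq_bigr do rewrite mxtrace_projector_emb mulrA.
rewrite -mulr_suml mulrA.
(* An irreducible module is nonzero, so its basis has a member. *)
have [T _] : exists T : syt l mu, true.
  case: (pickP (@predT (syt l mu))) => [T _|none]; first by exists T.
  case: irr_mu => _ /negP []; rewrite -wv' big_pred0 // => T; exact: none.
rewrite (char_norm1 (v := v' T) cardS irr_mu) ?mul1r //.
  apply/eqP => v0; have := congr1 (fun M : 'M[F]_1 => M 0 0) (vw' T T).
  by rewrite /= v0 mul0mx eqxx !mxE mulr1n => /esym/eqP; rewrite oner_eq0.
exact: (syt_eigenline young_mu vw' wv' vX').
Qed.

End SkewCharacter.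

Theorem mainTheorem2 (R : realType) (l k : nat) (mu la : diagram)
    (rho : seq nat) (dmu dla : nat)
    (rmu : mx_representation R[i] [set: 'S_l] dmu)
    (rla : mx_representation R[i] [set: 'S_(l + k)] dla)
    (young_mu : young mu) (young_la : young la) (mu_la : (mu `<=` la)%fset)
    (size_mu : #|` mu| = l) (size_la : #|` la| = (l + k)%N)
    (k_gt0 : (0 < k)%N) (rhoP : is_partition k rho)
    (Vmu : is_irr_of_shape mu rmu) (Vla : is_irr_of_shape la rla)
    (s : 'S_k) (s_rho : cycle_type s = rho) :
  skew_char rmu rla s =
    \sum_(S : {ffun 'I_(size rho).+1 -> fpowerset la} | hook_seq mu S)
      (-1) ^+ seq_height S.
Proof.
have [irr_mu [v' [/dual_basis[w' [vw' wv']] vX']]] := Vmu.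
have [_ [v [/dual_basis[w [vw wv]] vX]]] := Vla.
have rho0 : 0%N \notin rho by case/and3P: rhoP.
rewrite (skew_char_hook_sum young_mu young_la mu_la size_mu size_la vw wv vX
           vw' wv' vX') // s_rho.
by rewrite sum_hook_seq.
Qed.
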